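(* Let $(\Omega,\mathscr F,\mathbb F=\{\mathscr F_t\}_{t\ge0},\mathbb P)$ be a complete filtered probability space and let $V_t=\sigma^2(t,\omega)$ be an Itô process satisfying $$dV_t=f(t,\omega)dt+g(t,\omega)dW_t,\qquad t\in[0,T],$$ where $W$ is a standard Wiener process adapted to $\mathbb F$, and $f,g$ are adapted and progressively measurable with respect to $\mathbb F$. Assume that $\mathbb E[f^2(t,\omega)]<M$ for all $t\in[0,T]$ and some constant $M$, and that $t\mapsto\mathbb E[g^2(t,\omega)]$ is continuous on $[0,T]$. Then for every $t\in(0,T)$, $$\mathbb E[(V_{t+r}-V_t)(V_{t+s}-V_t)]=L(t)C_1(r,s)+o\big((r^2+s^2)^{1/2}\big),\qquad r,s\to0,$$ with $C_1(r,s)=\min\{|r|,|s|\}1_{\{rs\ge0\}}$ and $L(t)=\mathbb E[g^2(t,\omega)]$. Furthermore, $C_1$ is integrally positive definite: $\iint K(x)K(y)C_1(x,y)dxdy>0$ for every $K:\mathbb R\to\mathbb R$ with $\int|K(x)|dx>0$ for which the integral is well defined.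
   Context: Here $r,s$ are real (of either sign) and small enough that $t+r,t+s\in[0,T]$. *)

(* Defs.v *)
From HB Require Import structures.
From mathcomp Require Export all_boot all_order all_algebra.
From mathcomp Require Export all_classical all_reals all_analysis.
Export Order.TTheory GRing.Theory Num.Theory.
Export numFieldNormedType.Exports.

#[export] Set Implicit Arguments.
#[export] Unset Strict Implicit.
#[export] Unset Printing Implicit Defensive.

Local Open Scope classical_set_scope.
Local Open Scope ring_scope.

Section Filtration.
Context {d : measure_display} {Om : measurableType d} {R : realType}.
Variable P : probability Om R.

(* Time runs over [0, +oo[; the values of processes and filtrations at negative
   times are never used. *)
Record complete_filtration (F : R -> set (set Om)) : Prop := CompleteFiltration {
  filtration_sigma : forall t : R, 0 <= t -> sigma_algebra setT (F t) ;
  filtration_sub : forall t : R, 0 <= t -> F t `<=` measurable ;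
  filtration_nondecreasing : forall s t : R, 0 <= s -> s <= t -> F s `<=` F t ;
  filtration_space_complete : measure_is_complete P ;
  filtration_negligible : P.-negligible `<=` F 0 }.

Definition measurable_wrt (G : set (set Om)) (X : Om -> R) : Prop :=
  forall Y : set R, measurable Y -> G (X @^-1` Y).

Definition adapted (F : R -> set (set Om)) (T : R) (X : R -> Om -> R) : Prop :=
  forall t : R, 0 <= t <= T -> measurable_wrt (F t) (X t).

(* The generated sigma-algebra is B([0, t]) (x) F_t, on the set [0, t] x Om. *)
Definition progressively_measurable
    (F : R -> set (set Om)) (T : R) (X : R -> Om -> R) : Prop :=
  forall t : R, 0 <= t <= T -> forall Y : set R, measurable Y ->
    <<s `[0, t] `*` setT,
        [set C | exists (A : set R) B, [/\ measurable A, A `<=` `[0, t], F t B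
                               & C = A `*` B]] >>
      [set p : R * Om | p.1 \in `[0, t] /\ Y (X p.1 p.2)].

(* Standard Wiener process relative to the filtration F: it is adapted and its
   increments after time s are independent of F_s. The second parameter of
   [normal_prob] is the standard deviation. *)
Record wiener_process (F : R -> set (set Om)) (W : R -> Om -> R) : Prop :=
  WienerProcess {
  wiener_adapted : forall T, adapted F T W ;
  wiener_start : {ae P, forall w, W 0 w = 0} ;
  wiener_continuous :
    {ae P, forall w, {within `[0, +oo[, continuous (W ^~ w)}} ;
  wiener_normal : forall s t : R, 0 <= s -> s < t ->
    forall Y : set R, measurable Y ->
    P ((fun w => W t w - W s w) @^-1` Y) =
      normal_prob 0 (Num.sqrt (t - s)) Y ;
  wiener_independent : forall s t : R, 0 <= s -> s < t ->
    forall (A : set Om) (Y : set R), F s A -> measurable Y ->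
    P (A `&` (fun w => W t w - W s w) @^-1` Y) =
      (P A * P ((fun w => (W t w - W s w)%R) @^-1` Y))%E }.

(* Simple process sum_(i < n) e_i 1_{]t_i, t_{i+1}]} on [0, T], with each e_i
   bounded and F_{t_i}-measurable. *)
Record simple_process (F : R -> set (set Om)) (T : R) := SimpleProcess {
  sp_size : nat ;
  sp_time : nat -> R ;
  sp_coef : nat -> Om -> R ;
  sp_time_ge0 : 0 <= sp_time 0%N ;
  sp_time_nondecreasing :
    forall i, (i < sp_size)%N -> sp_time i <= sp_time i.+1 ;
  sp_time_le : sp_time sp_size <= T ;
  sp_coef_measurable :
    forall i, (i < sp_size)%N -> measurable_wrt (F (sp_time i)) (sp_coef i) ;
  sp_coef_bounded :
    forall i, (i < sp_size)%N -> exists M : R, forall w, `|sp_coef i w| <= M }.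

Definition sp_val F T (phi : simple_process F T) (s : R) (w : Om) : R :=
  \sum_(i < sp_size phi)
    sp_coef phi i w * \1_(`]sp_time phi i, sp_time phi i.+1]) s.

Definition sp_integral (W : R -> Om -> R) F T (phi : simple_process F T)
    (t : R) (w : Om) : R :=
  \sum_(i < sp_size phi)
    sp_coef phi i w *
      (W (Num.min (sp_time phi i.+1) t) w - W (Num.min (sp_time phi i) t) w).

(* [ito_integral F W T g I]: I is (a continuous version of) the process
   t |-> int_0^t g dW on [0, T], for a progressively measurable g such that
   E int_0^T g^2 ds < oo. As usual it is defined by L^2-approximation of g by
   simple processes. *)
Record ito_integral (F : R -> set (set Om)) (W : R -> Om -> R) (T : R)
    (g I : R -> Om -> R) : Prop := ItoIntegral {
  ito_integrand_progressive : progressively_measurable F T g ;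
  ito_integrand_L2 :
    (\int[P]_w \int[lebesgue_measure]_(s in `[0%R, T]) ((g s w ^+ 2)%:E)
      < +oo)%E ;
  ito_adapted : adapted F T I ;
  ito_continuous : {ae P, forall w, {within `[0, T], continuous (I ^~ w)}} ;
  ito_limit : exists phi : nat -> simple_process F T,
    (\int[P]_w \int[lebesgue_measure]_(s in `[0%R, T])
       ((sp_val (phi n) s w - g s w) ^+ 2)%:E)%E @[n --> \oo] --> 0%E /\
    (forall t : R, 0 <= t <= T ->
      'E_P[fun w => ((sp_integral W (phi n) t w - I t w) ^+ 2)%R]%E
        @[n --> \oo] --> 0%E) }.

(* dV_t = f dt + g dW_t on [0, T], in integrated form; the exceptional null set
   does not depend on t. *)
Record ito_process (F : R -> set (set Om)) (W : R -> Om -> R) (T : R)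
    (f g V : R -> Om -> R) : Prop := ItoProcess {
  ito_process_adapted : adapted F T V ;
  ito_process_drift : progressively_measurable F T f ;
  ito_process_drift_integrable :
    {ae P, forall w, lebesgue_measure.-integrable `[0, T] (EFin \o f ^~ w)} ;
  ito_process_eq : exists I : R -> Om -> R, ito_integral F W T g I /\
    {ae P, forall w, forall t : R, 0 <= t <= T ->
      V t w = V 0 w + (\int[lebesgue_measure]_(s in `[0, t]) (f s w))
              + I t w} }.

End Filtration.

Section IntegrallyPositiveDefinite.
Context {R : realType}.

Definition integral_well_defined {d} {X : measurableType d}
    (m : {measure set X -> \bar R}) (h : X -> \bar R) : Prop :=
  (\int[m]_x h^\+ x < +oo \/ \int[m]_x h^\- x < +oo)%E.

(* [completed_lebesgue_measure] lives on the Lebesgue sigma-algebra of R, so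
   that K ranges over all Lebesgue-measurable functions. *)
Definition integrally_positive_definite (C : R -> R -> R) : Prop :=
  let mu := @completed_lebesgue_measure R in
  forall K : R -> R,
    measurable_fun [set: caratheodory_type (wlength idfun)^*%mu] K ->
    (0 < \int[mu]_x `|(K x)%:E|)%E ->
    integral_well_defined (mu \x mu)%E
      (fun p => (K p.1 * K p.2 * C p.1 p.2)%:E) ->
    (0 < \int[(mu \x mu)%E]_p (K p.1 * K p.2 * C p.1 p.2)%:E)%E.

Definition C1 (r s : R) : R := if 0 <= r * s then Num.min `|r| `|s| else 0.

End IntegrallyPositiveDefinite.

(* Main.v *)
(** Write [V (t + r) - V t] as a stochastic integral plus a drift. The drift has
    second moment at most [M r^2], so by a weighted AM-GM inequality it changes
    the covariance by [o(|r| + |s|)] only. By the Ito isometry the increment of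
    the stochastic integral between two times has second moment the integral of
    [L], and polarization turns these second moments into a covariance
    which, [L] being continuous, is
    [L t * (|r| + |s| - |r - s|) / 2 = L t * C1 r s] up to [o(|r| + |s|)].

    For the positivity, [C1 x y] is the integral over [u] of [k x u * k y u],
    where [k x] is the indicator function of the interval between [0] and [x].
    When [K x * K y * C1 x y] is integrable, Fubini makes its integral that of
    the square of [u |-> \int K x * k x u dx]. If it vanished, [K] would have
    zero integral over almost every ray [[u, +oo[], [u > 0], or []-oo, u]],
    [u < 0], and hence be null. When only the positive part is known to be
    integrable, the nonnegativity of the form on truncations of [K] bounds the
    negative part by the positive one. *)

(* Over a time [r] the stochastic integral moves by an amount of order [sqrt |r|] in L2 and the
   drift by [|r|], so mixed terms are negligible. The weight in the AM-GM inequality is a constant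
   of order [1 / e], fixed before [r] and [s] are taken small; this produces the little-o in epsilon
   form without products of norms. The signs of [r] and [s] never need separate treatment in the
   stochastic part, because polarization asks only for second moments of increments between any two
   of the times [t], [t + r], [t + s]. The isometry is thus needed between arbitrary times, while
   the Ito integral is accessible only as a limit of simple integrals at fixed times.

   For the positivity, [K] is merely Lebesgue measurable and may fail to be integrable near 0.
   Information on it comes at almost every level [u], and only away from 0, so levels are first
   completed by limits from the right and [K] is then examined on intervals lying on one side of
   0. *)
From HB Require Import structures.
Require Import Defs.
From mathcomp Require Import ring lra measurable_realfun.

Local Open Scope classical_set_scope.
Local Open Scope ring_scope.

(** * Gaussian moments and independence *)

Section density.
Context d (T : measurableType d) (R : realType).
Variables (m n : {measure set T -> \bar R}) (p : T -> R).
Hypothesis mp : measurable_fun setT p.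
Hypothesis p0 : forall x, 0 <= p x.
Hypothesis np : forall A, measurable A -> n A = (\int[m]_(x in A) (p x)%:E)%E.
Local Open Scope ereal_scope.
Import HBNNSimple.

Let mEp : measurable_fun [set: T] (fun x => (p x)%:E).
Proof. exact/measurable_EFinP. Qed.

Let integral_density_indic A : measurable A ->
  \int[n]_x (\1_A x)%:E = \int[m]_x ((\1_A x)%:E * (p x)%:E).
Proof.
move=> mA; rewrite integral_indic// setIT np// integral_mkcond.
apply: eq_integral => x _; rewrite patchE indicE.
by case: ifPn => _; rewrite ?mul1e ?mul0e.
Qed.

Let integral_density_nnsfun (f : {nnsfun T >-> R}) :
  \int[n]_x (f x)%:E = \int[m]_x ((f x)%:E * (p x)%:E).
Proof.
under [LHS]eq_integral do rewrite fimfunE -fsumEFin//.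
rewrite [LHS]ge0_integral_fsum//; last 2 first.
  - by move=> r; exact/measurable_EFinP/measurableT_comp.
  - by move=> k x _; rewrite EFinM nnfun_muleindic_ge0.
under [RHS]eq_integral.
  move=> x xD; rewrite fimfunE -fsumEFin// ge0_mule_fsuml; last first.
    by move=> r; rewrite EFinM nnfun_muleindic_ge0.
  over.
rewrite [RHS]ge0_integral_fsum//; last 2 first.
  - move=> r; apply: emeasurable_funM => //.
    by apply/measurable_EFinP; do 2 apply/measurableT_comp => //.
  - move=> k x _; apply: mule_ge0; last by rewrite lee_fin.
    by rewrite EFinM nnfun_muleindic_ge0.
apply: eq_fsbigr => r; rewrite inE => -[t _ ftr].
rewrite integralZl_indic_nnsfun//= integral_density_indic//.
rewrite -ge0_integralZl//.
- by apply: eq_integral => x _; rewrite EFinM muleA.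
- apply: emeasurable_funM => //.
  by apply/measurable_EFinP; exact: measurable_indic.
- by move=> x _; rewrite mule_ge0 ?lee_fin.
- by rewrite lee_fin -ftr.
Qed.

(** Monotone convergence along simple approximations of [f] extends the cases of indicators and of
    simple functions. It will turn integrals against [normal_prob] into Lebesgue integrals. *)
Lemma ge0_integral_density (f : T -> \bar R) :
  measurable_fun setT f -> (forall x, 0 <= f x) ->
  \int[n]_x f x = \int[m]_x (f x * (p x)%:E).
Proof.
move=> mf f0; pose f_ := nnsfun_approx measurableT mf.
transitivity (limn (fun k => \int[n]_x (f_ k x)%:E)).
  rewrite -monotone_convergence//=.
  - apply: eq_integral => ? /[!inE] xD; apply/esym/cvg_lim => //=.
    exact: cvg_nnsfun_approx.
  - by move=> k; exact/measurable_EFinP/measurable_funTS.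
  - by move=> k ? _; rewrite lee_fin.
  - by move=> ? _ ? ? mn; rewrite lee_fin; exact/lefP/nd_nnsfun_approx.
transitivity (limn (fun k => \int[m]_x ((f_ k x)%:E * (p x)%:E))).
  by congr (limn _); apply/funext => k; exact: integral_density_nnsfun.
rewrite -monotone_convergence//=.
- apply: eq_integral => x /[!inE] xD; rewrite muleC; apply/cvg_lim => //=.
  under eq_fun do rewrite muleC.
  by apply: cvgeZl => //; exact: cvg_nnsfun_approx.
- by move=> k; apply: emeasurable_funM => //; exact/measurable_EFinP.
- by move=> k x _; rewrite mule_ge0 ?lee_fin.
- move=> x _ i j ij; rewrite lee_wpmul2r ?lee_fin//.
  exact/lefP/nd_nnsfun_approx.
Qed.

End density.

Section normal_moments.
Context (R : realType) (s : R).
Hypothesis s0 : 0 < s.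
Notation mu := (@lebesgue_measure R).
Let p := normal_pdf 0 s.

Let sN0 : s != 0. Proof. by rewrite gt_eqF. Qed.

Let pE x : p x = normal_peak s * expR (- x ^+ 2 / (s ^+ 2 *+ 2)).
Proof. by rewrite /p normal_pdfE// /normal_fun subr0. Qed.

Lemma is_derive_normal_pdf x :
  is_derive x (1 : R) p (- (x / s ^+ 2) * p x).
Proof.
rewrite (_ : p = fun x => normal_peak s * expR (- x ^+ 2 / (s ^+ 2 *+ 2))).
  apply: is_derive_eq; rewrite /GRing.scale/=; field.
  by [].
by apply/funext => y; rewrite pE.
Qed.

Let continuous_p : continuous p. Proof. exact: continuous_normal_pdf. Qed.

Lemma normal_pdf_opp x : p (- x) = p x.
Proof. by rewrite !pE sqrrN. Qed.

(** Integration by parts: as the derivative of [p] is [- (x / s ^+ 2) * p x], the function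
    [- s ^+ 2 * (x * p x)] is an antiderivative of [x ^+ 2 * p x - s ^+ 2 * p x]. Evenness of [p]
    merges the two boundary terms. *)
Lemma integral_normal_pdf_sqr n : (0 < n)%N ->
  (\int[mu]_(x in `[(- n%:R)%R, n%:R]) (x ^+ 2 * p x)%:E =
   (s ^+ 2)%:E * \int[mu]_(x in `[(- n%:R)%R, n%:R]) (p x)%:E
    - (s ^+ 2 * n%:R * p n%:R *+ 2)%:E)%E.
Proof.
move=> n0.
have nn : - n%:R < n%:R :> R by rewrite gtrN// ltr0n.
have dF x : is_derive x (1 : R) (fun x => - s ^+ 2 * (x * p x))
    (x ^+ 2 * p x - s ^+ 2 * p x).
  have ? := is_derive_normal_pdf x.
  by apply: is_derive_eq; rewrite /GRing.scale/=; field.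
have c1 : continuous (fun x : R => x ^+ 2 * p x).
  by move=> x; apply: cvgM; [exact: sqr_continuous|exact: continuous_p].
have c2 : continuous (fun x : R => s ^+ 2 * p x).
  by move=> x; apply: cvgM; [exact: cvg_cst|exact: continuous_p].
have i1 : mu.-integrable `[(- n%:R)%R, n%:R] (EFin \o (fun x => x ^+ 2 * p x)).
  apply: continuous_compact_integrable; first exact: segment_compact.
  exact: continuous_subspaceT.
have i2 : mu.-integrable `[(- n%:R)%R, n%:R] (EFin \o p).
  apply: continuous_compact_integrable; first exact: segment_compact.
  exact: continuous_subspaceT.
have i3 : mu.-integrable `[(- n%:R)%R, n%:R] (EFin \o (fun x => s ^+ 2 * p x)).
  apply: continuous_compact_integrable; first exact: segment_compact.
  exact: continuous_subspaceT.
rewrite -integralZl//=.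
have : (\int[mu]_(x in `[(- n%:R)%R, n%:R])
    ((x ^+ 2 * p x - s ^+ 2 * p x)%:E) = - (s ^+ 2 * n%:R * p n%:R *+ 2)%:E)%E.
  rewrite (continuous_FTC2 (F := fun x => - s ^+ 2 * (x * p x)) nn).
  - by rewrite normal_pdf_opp -EFinB -EFinN; congr EFin; ring.
  - by apply: continuous_subspaceT => x; apply: cvgB; [exact: c1|exact: c2].
  - have cF : continuous (fun x : R => - s ^+ 2 * (x * p x)).
      move=> x; apply: cvgM; first exact: cvg_cst.
      by apply: cvgM; [exact: cvg_id|exact: continuous_p].
    split; [by move=> x _; case: (dF x)|apply: cvg_at_right_filter|
      apply: cvg_at_left_filter]; exact: cF.
  - by move=> x _; rewrite derive1E; case: (dF x).
under eq_integral do rewrite EFinB.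
rewrite integralB//; rewrite -EFinN => e.
by rewrite -e [RHS]addeC subeK//; exact: integrable_fin_num i3.
Qed.

Let cvg_itv (f : R -> R) : continuous f -> (forall x, 0 <= f x) ->
  (\int[mu]_(x in `[(- n%:R)%R, n%:R]) (f x)%:E @[n --> \oo] -->
  \int[mu]_x (f x)%:E)%E.
Proof.
move=> cf f0.
have -> : [set: R] = \bigcup_n `[- n%:R, n%:R]%classic.
  apply/seteqP; split => // x _; exists (Num.bound `|x|) => //=.
  by rewrite in_itv/= -ler_norml ltW//; have := archi_boundP (normr_ge0 x).
apply: (@ge0_nondecreasing_set_cvg_integral _ (measurableTypeR R) R
  (fun n => `[(- n%:R)%R, n%:R]%classic)).
- apply/nondecreasing_seqP => n; rewrite subsetEset => x/=.
  rewrite !in_itv/= => /andP[h1 h2]; apply/andP; split.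
    by rewrite (le_trans _ h1)// lerN2 ler_nat.
  by rewrite (le_trans h2)// ler_nat.
- by [].
- move=> i; apply/measurable_EFinP/measurable_funTS.
  exact: continuous_measurable_fun.
- by move=> *; rewrite lee_fin.
Qed.

Lemma ge0_integral_normal_prob (f : R -> \bar R) :
  measurable_fun setT f -> (forall x, 0 <= f x)%E ->
  (\int[normal_prob 0 s]_x f x = \int[mu]_x (f x * (p x)%:E))%E.
Proof.
move=> mf f0; apply: (ge0_integral_density (T := measurableTypeR R)) => //.
  exact: measurable_normal_pdf.
by move=> x; exact: normal_pdf_ge0.
Qed.

Lemma normal_prob_second_moment :
  (\int[normal_prob 0 s]_x (x ^+ 2)%:E = (s ^+ 2)%:E)%E.
Proof.
rewrite ge0_integral_normal_prob//; last 2 first.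
  - by apply/measurable_EFinP; exact: measurable_funX.
  - by move=> x; rewrite lee_fin sqr_ge0.
under eq_integral do rewrite -EFinM.
have c1 : continuous (fun x : R => x ^+ 2 * p x).
  by move=> x; apply: cvgM; [exact: sqr_continuous|exact: continuous_p].
have p_ge0 x : 0 <= p x by exact: normal_pdf_ge0.
have h0 x : 0 <= x ^+ 2 * p x by rewrite mulr_ge0// sqr_ge0.
apply: (@cvg_unique _ _ _ _ _ _ (cvg_itv c1 h0)) => //.
apply: (@cvg_trans _ ((fun n : nat => (s ^+ 2)%:E *
    \int[mu]_(x in `[(- n%:R)%R, n%:R]) (p x)%:E
    - (s ^+ 2 * n%:R * p n%:R *+ 2)%:E)%E @ \oo)).
  apply: near_eq_cvg; near=> n.
  by rewrite -integral_normal_pdf_sqr//; near: n; exact: nbhs_infty_gt.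
suff : ((s ^+ 2)%:E * \int[mu]_(x in `[(- n%:R)%R, n%:R]) (p x)%:E
    - (s ^+ 2 * n%:R * p n%:R *+ 2)%:E @[n --> \oo] -->
    (s ^+ 2)%:E * \int[mu]_x (p x)%:E - 0%:E)%E.
  by rewrite integral_normal_pdf mule1 sube0.
apply: cvgeB.
- by rewrite integral_normal_pdf mule1.
- by apply: cvgeZl => //; exact: cvg_itv.
apply: cvg_EFin; first by near=> n.
(* With [y = n ^ 2 / (2 s ^ 2)], the inequality [1 + y <= expR y] gives [expR (- y) <= y^-1], so the
   boundary term is at most [4 s ^ 4 * normal_peak s / n]. *)
apply: (@squeeze_cvgr _ _ _ _ (cst 0)
  (fun n : nat => s ^+ 4 * normal_peak s * 4 * n%:R^-1)); last 2 first.
- exact: cvg_cst.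
- rewrite -[X in _ --> X](mulr0 (s ^+ 4 * normal_peak s * 4)).
  apply: cvgM; first exact: cvg_cst.
  apply/gtr0_cvgV0; last exact: cvgr_idn.
  by near=> n; rewrite ltr0n; near: n; exact: nbhs_infty_gt.
- near=> n => /=.
  have n0 : 0 < n%:R :> R by rewrite ltr0n; near: n; exact: nbhs_infty_gt.
  apply/andP; split; first apply: mulrn_wge0.
    by apply: mulr_ge0 (p_ge0 _); apply: mulr_ge0; [exact: sqr_ge0|exact: ltW].
  rewrite pE.
  set y : R := n%:R ^+ 2 / (s ^+ 2 *+ 2).
  have y0 : 0 < y by rewrite divr_gt0 ?exprn_gt0// pmulrn_lgt0// exprn_gt0.
  have ey : expR (- n%:R ^+ 2 / (s ^+ 2 *+ 2)) <= y^-1.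
    rewrite mulNr expRN lef_pV2 ?posrE ?expR_gt0//.
    by rewrite (le_trans _ (expR_ge1Dx _))// lerDr.
  apply: (@le_trans _ _ (s ^+ 2 * n%:R * (normal_peak s * y^-1) *+ 2)).
    rewrite lerMn2r; apply/orP; right.
    apply: ler_wpM2l; first by rewrite mulr_ge0 ?sqr_ge0.
    exact: ler_wpM2l (normal_peak_ge0 _) _ _ ey.
  rewrite le_eqVlt; apply/orP; left; apply/eqP; rewrite /y; field.
  by rewrite sN0 gt_eqF.
Unshelve. all: by end_near. Qed.

(** By the symmetry of the density, the positive and negative parts of the identity have equal
    integrals. These must also be finite for their difference to be 0, which follows from the second
    moment, as each part is at most [1 + x ^+ 2]. *)
Lemma normal_prob_mean : (\int[normal_prob 0 s]_x x%:E = 0)%E.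
Proof.
pose E : R -> \bar R := fun x => x%:E.
have mE : measurable_fun [set: R] E by exact/measurable_EFinP.
have mpos : measurable_fun [set: R] (E^\+)%E by exact: measurable_funepos.
have mneg : measurable_fun [set: R] (E^\-)%E by exact: measurable_funeneg.
rewrite integralE.
have -> : (\int[normal_prob 0 s]_x E^\- x = \int[normal_prob 0 s]_x E^\+ x)%E.
  have mEp : measurable_fun [set: R] (fun x => (E^\+ x * (p x)%:E)%E).
    apply: emeasurable_funM => //.
    by apply/measurable_EFinP; exact: measurable_normal_pdf.
  rewrite !ge0_integral_normal_prob//.
  transitivity (\int[pushforward mu (-%R : _ -> measurableTypeR R)]_x
      (E^\+ x * (p x)%:E))%E; last first.
    by apply: eq_measure_integral => A mA _; rewrite -[RHS]lebesgue_measureN.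
  rewrite ge0_integral_pushforward//.
    apply: eq_integral => x _ /=.
    by rewrite normal_pdf_opp funenegE funeposE /E EFinN.
  by move=> x _; rewrite mule_ge0// lee_fin normal_pdf_ge0.
rewrite subee// ge0_fin_numE ?integral_ge0//.
apply: (@le_lt_trans _ _ (\int[normal_prob 0 s]_x (1 + (x ^+ 2)%:E))%E).
  apply: ge0_le_integral => //.
  - by apply/measurable_EFinP; apply: measurable_funD => //; exact: measurable_funX.
  - move=> x _; rewrite funeposE /E -EFin_max -EFinD lee_fin ge_max.
    by apply/andP; split; nra.
rewrite ge0_integralD//; last 2 first.
  - by move=> x _; rewrite lee_fin sqr_ge0.
  - by apply/measurable_EFinP; exact: measurable_funX.
rewrite normal_prob_second_moment integral_cst// mul1e.
rewrite [X in (X + _)%E](_ : _ = 1%E) ?ltry//.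
exact: (@probability_setT _ _ _ (normal_prob 0 s)).
Qed.
End normal_moments.

Section independence.
Context d (Om : measurableType d) (R : realType) (P : probability Om R).

Definition independent_rv (X Y : Om -> R) : Prop :=
  forall A B : set R, measurable A -> measurable B ->
  P (X @^-1` A `&` Y @^-1` B) = (P (X @^-1` A) * P (Y @^-1` B))%E.

Lemma independent_rv_comp (X Y : Om -> R) (f g : R -> R) :
  measurable_fun setT f -> measurable_fun setT g ->
  independent_rv X Y -> independent_rv (f \o X) (g \o Y).
Proof.
move=> mf mg XY A B mA mB; apply: (XY (f @^-1` A) (g @^-1` B)).
- by rewrite -[X in measurable X]setTI; exact: mf.
- by rewrite -[X in measurable X]setTI; exact: mg.
Qed.

Local Open Scope ereal_scope.

(** Independence on rectangles makes the law of the pair the product of the two laws, by uniqueness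
    of product measures. Tonelli then gives the integrability of the product and Fubini its
    expectation. *)
Let integrable_independent_mulfun (X Y : {RV P >-> R}) : independent_rv X Y ->
  P.-integrable setT (EFin \o X) -> P.-integrable setT (EFin \o Y) ->
  P.-integrable setT (fun w => (X w * Y w)%:E) /\
  \int[P]_w (X w * Y w)%:E = \int[P]_w (X w)%:E * \int[P]_w (Y w)%:E.
Proof.
move=> XY iX iY.
pose Z w := (X w, Y w).
have mZ : measurable_fun setT Z by exact: measurable_fun_pair.
pose Zm : {RV P >-> (R * R)%type} := mfun_Sub (mem_set mZ).
have law A : measurable A ->
    (distribution P X \x distribution P Y) A = distribution P Zm A.
  apply: product_measure_unique => B C mB mC.
  by rewrite -XY.
have mxy : measurable_fun [set: R * R] (fun z : R * R => (z.1 * z.2)%:E).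
  by apply/measurable_EFinP; exact: measurable_funM.
have mabs : measurable_fun [set: R] (fun x : R => `|x|%:E).
  by apply/measurable_EFinP; exact: normr_measurable.
have iX' : \int[P]_w `|X w|%:E < +oo by case/integrableP : iX.
have iY' : \int[P]_w `|Y w|%:E < +oo by case/integrableP : iY.
have fX : \int[P]_w `|X w|%:E \is a fin_num by rewrite ge0_fin_numE ?integral_ge0.
have fY : \int[P]_w `|Y w|%:E \is a fin_num by rewrite ge0_fin_numE ?integral_ge0.
have iXY : P.-integrable setT (fun w => (X w * Y w)%:E).
  apply/integrableP; split.
    by apply/measurable_EFinP; exact: measurable_funM.
  rewrite -(ge0_integral_distribution Zm
    (f := fun z => `|(z.1 * z.2)%:E|))//; last exact: measurableT_comp.
  rewrite (eq_measure_integral (distribution P X \x distribution P Y)); last first.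
  by move=> A mA _; exact/esym/law.
  rewrite fubini_tonelli1//; last exact: measurableT_comp.
  rewrite /fubini_F/=.
  have -> : \int[distribution P X]_x \int[distribution P Y]_y `|x * y|%:E =
      \int[distribution P X]_x (`|x|%:E * \int[P]_w `|Y w|%:E).
    apply: eq_integral => x _.
    under eq_integral do rewrite normrM EFinM.
    rewrite ge0_integralZl//.
    by rewrite (ge0_integral_distribution Y (f := fun y => `|y|%:E)).
  rewrite ge0_integralZr//; last exact: integral_ge0.
  rewrite (ge0_integral_distribution X (f := fun y => `|y|%:E))//.
  by apply: lte_mul_pinfty; [by apply: integral_ge0 => w _; rewrite lee_fin|exact: fX|exact: iY'].
split=> //.
rewrite -(integral_distribution (X := Zm)
  (f := fun z => (z.1 * z.2)%:E))//.
rewrite (eq_measure_integral (distribution P X \x distribution P Y)); last first.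
  by move=> A mA _; exact/esym/law.
have jXY : (distribution P X \x distribution P Y).-integrable setT
    (fun z : R * R => (z.1 * z.2)%:E).
  apply/integrableP; split=> //.
  rewrite (eq_measure_integral (distribution P Zm)); last first.
    by move=> A mA _; exact: law.
  rewrite (ge0_integral_distribution Zm
    (f := fun z => `|(z.1 * z.2)%:E|))//; last exact: measurableT_comp.
  by case/integrableP : iXY.
rewrite -integral12_prod_meas1// /fubini_F/=.
have iid : (distribution P Y).-integrable setT (@EFin R).
  apply/integrableP; split; first exact/measurable_EFinP.
  by rewrite (ge0_integral_distribution Y (f := fun y => `|y%:E|)).
have iid' : (distribution P X).-integrable setT (@EFin R).
  apply/integrableP; split; first exact/measurable_EFinP.
  by rewrite (ge0_integral_distribution X (f := fun y => `|y%:E|)).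
have eY : \int[distribution P Y]_y y%:E = \int[P]_w (Y w)%:E.
  by rewrite (integral_distribution (X := Y) (f := @EFin R))//;
    exact/measurable_EFinP.
have eX : \int[distribution P X]_y y%:E = \int[P]_w (X w)%:E.
  by rewrite (integral_distribution (X := X) (f := @EFin R))//;
    exact/measurable_EFinP.
have fEY : \int[distribution P Y]_y y%:E \is a fin_num.
  by apply: integrable_fin_num.
under eq_integral do (under eq_integral do rewrite EFinM).
rewrite -eX -eY.
under eq_integral do rewrite integralZl//.
rewrite -(fineK fEY).
by rewrite integralZr.
Qed.

Lemma independent_expectation_mul (X Y : Om -> R) :
  measurable_fun setT X -> measurable_fun setT Y -> independent_rv X Y ->
  P.-integrable setT (EFin \o X) -> P.-integrable setT (EFin \o Y) ->
  P.-integrable setT (fun w => (X w * Y w)%:E) /\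
  \int[P]_w (X w * Y w)%:E = \int[P]_w (X w)%:E * \int[P]_w (Y w)%:E.
Proof.
move=> mX mY; exact: (@integrable_independent_mulfun
  (mfun_Sub (mem_set mX)) (mfun_Sub (mem_set mY))).
Qed.

End independence.

(** * Square-integrable functions and limits of second moments *)

Section square_integrable.
Context d (T : measurableType d) (R : realType) (mu : {measure set T -> \bar R}).
Implicit Types X Y : T -> R.
Local Open Scope ereal_scope.

Definition square_integrable X : Prop :=
  measurable_fun setT X /\ \int[mu]_x (X x ^+ 2)%:E < +oo.

Lemma measurable_sqrE X : measurable_fun setT X ->
  measurable_fun setT (fun x => (X x ^+ 2)%:E).
Proof. by move=> mX; apply/measurable_EFinP; exact: measurable_funX. Qed.

Lemma integral_sqr_ge0 X : 0 <= \int[mu]_x (X x ^+ 2)%:E.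
Proof. by apply: integral_ge0 => x _; rewrite lee_fin sqr_ge0. Qed.

Lemma square_integrable_sqr X : square_integrable X ->
  mu.-integrable setT (fun x => (X x ^+ 2)%:E).
Proof.
move=> [mX X2]; apply/integrableP; split; first exact: measurable_sqrE.
by under eq_integral do rewrite gee0_abs ?lee_fin ?sqr_ge0//.
Qed.

(* From [(x + y)^2 <= (1 + e) x^2 + (1 + 1/e) y^2]. *)
Lemma integral_sqrD_le X Y (e : R) : (0 < e)%R ->
  measurable_fun setT X -> measurable_fun setT Y ->
  \int[mu]_x ((X x + Y x) ^+ 2)%:E <=
  (1 + e)%:E * \int[mu]_x (X x ^+ 2)%:E +
  (1 + e^-1)%:E * \int[mu]_x (Y x ^+ 2)%:E.
Proof.
move=> e0 mX mY.
have ei : (0 < e^-1)%R by rewrite invr_gt0.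
have ee : (e * e^-1 = 1)%R by rewrite divff// gt_eqF.
rewrite -!ge0_integralZl//; try exact: measurable_sqrE;
  try (by move=> *; rewrite lee_fin sqr_ge0); try (by rewrite lee_fin; lra).
rewrite -ge0_integralD//; first last.
- by apply: measurable_funeM; exact: measurable_sqrE.
- by move=> x _; rewrite -EFinM lee_fin mulr_ge0 ?sqr_ge0//; lra.
- by apply: measurable_funeM; exact: measurable_sqrE.
- by move=> x _; rewrite -EFinM lee_fin mulr_ge0 ?sqr_ge0//; lra.
apply: ge0_le_integral => //.
- by move=> x _; rewrite lee_fin sqr_ge0.
- by apply: measurable_sqrE; exact: measurable_funD.
- by apply: emeasurable_funD; apply: measurable_funeM; exact: measurable_sqrE.
- move=> x _; rewrite -!EFinM -EFinD lee_fin.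
  have : (0 <= e^-1 * (e * X x - Y x) ^+ 2)%R by rewrite mulr_ge0 ?sqr_ge0// ltW.
  suff -> : (e^-1 * (e * X x - Y x) ^+ 2 =
    (e * e^-1) * (e * X x ^+ 2) - (e * e^-1) * X x * Y x *+ 2 + e^-1 * Y x ^+ 2)%R.
    by rewrite ee; nra.
  by ring.
Qed.

Lemma square_integrableD X Y : square_integrable X -> square_integrable Y ->
  square_integrable (X \+ Y)%R.
Proof.
move=> [mX X2] [mY Y2]; split; first exact: measurable_funD.
apply: (le_lt_trans (integral_sqrD_le ltr01 mX mY)).
by rewrite lte_add_pinfty// lte_mul_pinfty// lee_fin; rewrite ?invr1; lra.
Qed.

Lemma square_integrableN X : square_integrable X -> square_integrable (\- X)%R.
Proof.
move=> [mX X2]; split; first exact: measurableT_comp.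
by under eq_integral do rewrite sqrrN.
Qed.

Lemma square_integrableB X Y : square_integrable X -> square_integrable Y ->
  square_integrable (X \- Y)%R.
Proof. by move=> ? ?; apply: square_integrableD => //; exact: square_integrableN. Qed.

Lemma square_integrable_mul X Y : square_integrable X -> square_integrable Y ->
  mu.-integrable setT (fun x => (X x * Y x)%:E).
Proof.
move=> sX sY; have [mX _] := sX; have [mY _] := sY.
apply: (@le_integrable _ _ _ _ _ measurableT _
  (fun x => (X x ^+ 2)%:E + (Y x ^+ 2)%:E)).
- by apply/measurable_EFinP; exact: measurable_funM.
- move=> x _; rewrite -EFinD /= lee_fin.
  rewrite [leRHS]ger0_norm; last by rewrite addr_ge0// sqr_ge0.
  by rewrite ler_norml; apply/andP; split; nra.
- by apply: integrableD => //; exact: square_integrable_sqr.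
Qed.

End square_integrable.

Section isometry_limit.
Context d1 (T1 : measurableType d1) d2 (T2 : measurableType d2) (R : realType).
Variables (m1 : {measure set T1 -> \bar R}) (m2 : {measure set T2 -> \bar R}).
Variables (u_ : nat -> T1 -> R) (u : T1 -> R) (v_ : nat -> T2 -> R) (v : T2 -> R).
Hypotheses (mu_ : forall n, measurable_fun setT (u_ n)) (mu : measurable_fun setT u).
Hypotheses (mv_ : forall n, measurable_fun setT (v_ n)) (mv : measurable_fun setT v).
Local Open Scope ereal_scope.
Hypothesis uv_ : forall n, \int[m1]_x (u_ n x ^+ 2)%:E = \int[m2]_x (v_ n x ^+ 2)%:E.
Hypothesis cu : \int[m1]_x ((u_ n x - u x) ^+ 2)%:E @[n --> \oo] --> 0.
Hypothesis cv : \int[m2]_x ((v_ n x - v x) ^+ 2)%:E @[n --> \oo] --> 0.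

(** The two sequences live in different L2 spaces and share only their norms. Writing
    [u = u_n + (u - u_n)] and [v_n = v + (v_n - v)] costs a factor [1 + e] each time, plus error
    terms that vanish as [n] grows; then [e] tends to 0. *)
Lemma le_integral_sqr_limit :
  \int[m1]_x (u x ^+ 2)%:E <= \int[m2]_x (v x ^+ 2)%:E.
Proof.
have [->|] := eqVneq (\int[m2]_x (v x ^+ 2)%:E) +oo; first by rewrite leey.
rewrite -ltey => vfin.
pose a := fine (\int[m2]_x (v x ^+ 2)%:E).
have aE : \int[m2]_x (v x ^+ 2)%:E = a%:E.
  by rewrite /a fineK// ge0_fin_numE// integral_sqr_ge0.
have a0 : (0 <= a)%R by rewrite -lee_fin -aE integral_sqr_ge0.
have step (e : R) : (0 < e)%R ->
    \int[m1]_x (u x ^+ 2)%:E <= ((1 + e) * ((1 + e) * a))%:E.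
  move=> e0; have ei : (0 < e^-1)%R by rewrite invr_gt0.
  have c : (fun n => (1 + e)%:E * ((1 + e)%:E * a%:E + (1 + e^-1)%:E *
      \int[m2]_x ((v_ n x - v x) ^+ 2)%:E) +
      (1 + e^-1)%:E * \int[m1]_x ((u_ n x - u x) ^+ 2)%:E) @ \oo -->
      (1 + e)%:E * ((1 + e)%:E * a%:E + (1 + e^-1)%:E * 0) + (1 + e^-1)%:E * 0.
    have c1 : (1 + e^-1)%:E * \int[m2]_x ((v_ n x - v x) ^+ 2)%:E @[n --> \oo] -->
        (1 + e^-1)%:E * 0 by exact: cvgeZl.
    have c2 : (1 + e^-1)%:E * \int[m1]_x ((u_ n x - u x) ^+ 2)%:E @[n --> \oo] -->
        (1 + e^-1)%:E * 0 by exact: cvgeZl.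
    apply: cvgeD c2; first by rewrite !mule0 adde0.
    apply: cvgeZl => //; apply: cvgeD c1; first by rewrite mule0.
    exact: cvg_cst.
  rewrite !mule0 !adde0 in c; rewrite !EFinM; apply: cvge_ge c; near=> n.
  have -> : \int[m1]_x (u x ^+ 2)%:E =
      \int[m1]_x ((u_ n x + (u x - u_ n x)) ^+ 2)%:E.
    by apply: eq_integral => x _; rewrite subrKC.
  apply: (le_trans (integral_sqrD_le m1 e0 (mu_ n) (measurable_funB mu (mu_ n)))).
  rewrite leeD//; last first.
    by under eq_integral do rewrite -sqrrN opprB.
  rewrite lee_pmul2l//; last by rewrite lte_fin; lra.
  rewrite uv_ (_ : \int[m2]_x (v_ n x ^+ 2)%:E =
      \int[m2]_x ((v x + (v_ n x - v x)) ^+ 2)%:E); last first.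
    by apply: eq_integral => x _; rewrite subrKC.
  rewrite -aE.
  exact: (integral_sqrD_le m2 e0 mv (measurable_funB (mv_ n) mv)).
rewrite aE; apply/lee_addgt0Pr => h h0.
(* For [e <= 1], [(1 + e) ^ 2 * a <= a + 3 * e * a]; the [+ 1] keeps the denominator positive when
   [a = 0]. *)
pose e := (Num.min 1 (h / (3 * a + 1)))%R.
have a1 : (0 < 3 * a + 1)%R by lra.
have e0 : (0 < e)%R by rewrite lt_min ltr01 divr_gt0.
apply: (le_trans (step _ e0)); rewrite -EFinD lee_fin.
have e1 : (e <= 1)%R by rewrite ge_min lexx.
have : (e * (3 * a + 1) <= h)%R.
  by rewrite -ler_pdivlMr// ge_min lexx orbT.
nra.
Unshelve. all: by end_near. Qed.

End isometry_limit.

Lemma eq_integral_sqr_limit d1 (T1 : measurableType d1) d2 (T2 : measurableType d2)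
    (R : realType) (m1 : {measure set T1 -> \bar R}) (m2 : {measure set T2 -> \bar R})
    (u_ : nat -> T1 -> R) (u : T1 -> R) (v_ : nat -> T2 -> R) (v : T2 -> R) :
  (forall n, measurable_fun setT (u_ n)) -> measurable_fun setT u ->
  (forall n, measurable_fun setT (v_ n)) -> measurable_fun setT v ->
  (forall n, \int[m1]_x (u_ n x ^+ 2)%:E = \int[m2]_x (v_ n x ^+ 2)%:E)%E ->
  (\int[m1]_x ((u_ n x - u x) ^+ 2)%:E @[n --> \oo] --> 0)%E ->
  (\int[m2]_x ((v_ n x - v x) ^+ 2)%:E @[n --> \oo] --> 0)%E ->
  (\int[m1]_x (u x ^+ 2)%:E = \int[m2]_x (v x ^+ 2)%:E)%E.
Proof.
move=> mu_ mu mv_ mv uv cu cv; apply/eqP; rewrite eq_le; apply/andP; split.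
- exact: (le_integral_sqr_limit mu_ mu mv_ mv uv cu cv).
- exact: (le_integral_sqr_limit mv_ mv mu_ mu (fun n => esym (uv n)) cv cu).
Qed.

(** * Ito isometry *)

Section measurable_wrt.
Context d (Om : measurableType d) (R : realType).
Variable G : set (set Om).
Implicit Types X Y : Om -> R.

Lemma measurable_wrt_subset (H : set (set Om)) X :
  G `<=` H -> measurable_wrt G X -> measurable_wrt H X.
Proof. by move=> GH mX A /mX /GH. Qed.

Lemma measurable_wrt_fun X :
  G `<=` measurable -> measurable_wrt G X -> measurable_fun setT X.
Proof. by move=> Gm mX _ A mA; rewrite setTI; exact/Gm/mX. Qed.

Hypothesis sG : sigma_algebra setT G.

(** A sigma-algebra equals the one it generates. This lends to [G], a mere set of sets, the closure
    properties of measurable functions. *)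
Lemma measurable_wrtP X : measurable_wrt G X <->
  measurable_fun [set: g_sigma_algebraType G] (X : g_sigma_algebraType G -> R).
Proof.
split=> mX.
- move=> _ A mA; rewrite setTI.
  by apply: sub_sigma_algebra; exact: mX.
- by move=> A mA; have := mX measurableT A mA; rewrite setTI measurable_g_measurableTypeE.
Qed.

Lemma measurable_wrtD X Y : measurable_wrt G X -> measurable_wrt G Y ->
  measurable_wrt G (X \+ Y).
Proof.
move=> /measurable_wrtP mX /measurable_wrtP mY.
by apply/measurable_wrtP; exact: measurable_funD.
Qed.

Lemma measurable_wrtB X Y : measurable_wrt G X -> measurable_wrt G Y ->
  measurable_wrt G (X \- Y).
Proof.
move=> /measurable_wrtP mX /measurable_wrtP mY.
by apply/measurable_wrtP; exact: measurable_funB.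
Qed.

Lemma measurable_wrtM X Y : measurable_wrt G X -> measurable_wrt G Y ->
  measurable_wrt G (X \* Y).
Proof.
move=> /measurable_wrtP mX /measurable_wrtP mY.
by apply/measurable_wrtP; exact: measurable_funM.
Qed.

Lemma measurable_wrt_cst (c : R) : measurable_wrt G (cst c).
Proof. by apply/measurable_wrtP; exact: measurable_cst. Qed.

End measurable_wrt.

Section simple_isometry.
Context d (Om : measurableType d) (R : realType) (P : probability Om R).
Variables (F : R -> set (set Om)) (W : R -> Om -> R).
Hypotheses (hF : complete_filtration P F) (hW : wiener_process P F W).

Lemma wiener_measurable (t : R) : 0 <= t -> measurable_wrt (F t) (W t).
Proof. by move=> t0; apply: (wiener_adapted hW (T := t)); rewrite t0 lexx. Qed.

Lemma filtration_measurable (t : R) (X : Om -> R) : 0 <= t ->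
  measurable_wrt (F t) X -> measurable_fun setT X.
Proof. by move=> t0; apply: measurable_wrt_fun; exact: filtration_sub hF _ t0. Qed.

Lemma wiener_increment_wrt (s t : R) : 0 <= s -> s <= t ->
  measurable_wrt (F t) (W t \- W s).
Proof.
move=> s0 st; have t0 := le_trans s0 st.
apply: measurable_wrtB; first exact: filtration_sigma hF _ t0.
  exact: wiener_measurable.
apply: measurable_wrt_subset (wiener_measurable s0).
exact: filtration_nondecreasing hF _ _ s0 st.
Qed.

Local Open Scope ereal_scope.

Lemma wiener_increment_law (s t : R) (f : R -> \bar R) :
  (0 <= s)%R -> (s < t)%R -> measurable_fun setT f ->
  (forall x, 0 <= f x) \/ P.-integrable setT (f \o (W t \- W s)%R) ->
  \int[P]_w f (W t w - W s w)%R = \int[normal_prob 0 (Num.sqrt (t - s))]_x f x.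
Proof.
move=> s0 st mf hf.
have mD : measurable_fun setT (W t \- W s)%R.
  apply: (@filtration_measurable t); first exact: le_trans s0 (ltW st).
  by apply: wiener_increment_wrt => //; exact: ltW.
(* [normal_prob] lives on [measurableTypeR R], whose display is not that of [R]. *)
have mD' : @measurable_fun _ _ Om (measurableTypeR R) setT (W t \- W s)%R := mD.
pose D : {RV P >-> measurableTypeR R} :=
  @mfun_Sub _ _ Om (measurableTypeR R) _ (mem_set mD').
transitivity (\int[distribution P D]_x f x).
  by case: hf => hf; [rewrite (ge0_integral_distribution D)
    |rewrite (integral_distribution (X := D))].
by apply: eq_measure_integral => A mA _; exact: (wiener_normal hW).
Qed.

Lemma wiener_increment_sqr (s t : R) : (0 <= s)%R -> (s <= t)%R ->
  \int[P]_w ((W t w - W s w) ^+ 2)%:E = (t - s)%:E.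
Proof.
move=> s0; rewrite le_eqVlt => /predU1P[<-|st].
  by rewrite subrr; apply: integral0_eq => w _; rewrite subrr expr0n.
rewrite (wiener_increment_law (f := fun x => (x ^+ 2)%:E))//.
- rewrite normal_prob_second_moment ?sqrtr_gt0 ?subr_gt0//.
  by rewrite sqr_sqrtr// subr_ge0 ltW.
- by apply/measurable_EFinP; exact: measurable_funX.
- by left=> x; rewrite lee_fin sqr_ge0.
Qed.

Lemma wiener_increment_square_integrable (s t : R) : (0 <= s)%R -> (s <= t)%R ->
  square_integrable P (W t \- W s)%R.
Proof.
move=> s0 st; split; last by rewrite wiener_increment_sqr// ltry.
apply: (@filtration_measurable t); first exact: le_trans s0 st.
exact: wiener_increment_wrt.
Qed.

Lemma square_integrable_cst (c : R) : square_integrable P (cst c).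
Proof.
split=> //; have := integral_cst P measurableT (c ^+ 2)%:E.
by move=> ->; rewrite ltey_eq fin_numM//; exact: (fin_num_measure P).
Qed.

Lemma square_integrable_integrable (X : Om -> R) :
  square_integrable P X -> P.-integrable setT (EFin \o X).
Proof.
move=> sX; have := square_integrable_mul sX (square_integrable_cst 1%R).
by under eq_fun do rewrite mulr1.
Qed.

Lemma wiener_increment_mean (s t : R) : (0 <= s)%R -> (s <= t)%R ->
  \int[P]_w (W t w - W s w)%:E = 0.
Proof.
move=> s0; rewrite le_eqVlt => /predU1P[<-|st].
  by apply: integral0_eq => w _; rewrite subrr.
rewrite (wiener_increment_law (f := @EFin R))//.
- by rewrite normal_prob_mean// sqrtr_gt0 subr_gt0.
- right; apply: square_integrable_integrable.
  exact: wiener_increment_square_integrable s0 (ltW st).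
Qed.

Lemma wiener_increment_independent (s t : R) (X : Om -> R) :
  (0 <= s)%R -> (s < t)%R -> measurable_wrt (F s) X ->
  independent_rv P X (W t \- W s)%R.
Proof. by move=> s0 st mX A B mA mB; apply: (wiener_independent hW) => //; exact: mX. Qed.

(** Expand the square of [S + e * D], where [D] is the Wiener increment. The product [S * e] is
    known at time [s], hence independent of the centred [D], so the cross term has mean 0; and
    [e ^+ 2] is independent of [D ^+ 2], whose mean is [t - s]. Independence is stated for [s < t],
    so equal times are treated apart. *)
Lemma simple_isometry_step (s t : R) (S e : Om -> R) :
  (0 <= s)%R -> (s <= t)%R ->
  measurable_wrt (F s) S -> measurable_wrt (F s) e ->
  square_integrable P S -> square_integrable P e ->
  let S' w := (S w + e w * (W t w - W s w))%R in
  [/\ measurable_wrt (F t) S', square_integrable P S' &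
  \int[P]_w (S' w ^+ 2)%:E =
  \int[P]_w (S w ^+ 2)%:E + \int[P]_w (e w ^+ 2)%:E * (t - s)%:E].
Proof.
move=> s0 st mS me sS se S'.
have t0 := le_trans s0 st.
have FF := filtration_nondecreasing hF s0 st.
have mS' : measurable_wrt (F t) S'.
  apply: (measurable_wrtD (filtration_sigma hF t0)).
    exact: measurable_wrt_subset mS.
  apply: (measurable_wrtM (filtration_sigma hF t0)).
    exact: measurable_wrt_subset me.
  exact: wiener_increment_wrt.
have mS'T := filtration_measurable t0 mS'.
move: st; rewrite le_eqVlt => /predU1P[st|st].
  have S'E : S' = S by apply/funext => w; rewrite /S' -st subrr mulr0 addr0.
  by split=> //; rewrite S'E// -st subrr mule0 adde0.
pose D := (W t \- W s)%R.
have sD : square_integrable P D.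
  exact: wiener_increment_square_integrable s0 (ltW st).
have [mST _] := sS; have [meT _] := se; have [mDT _] := sD.
have iSe : P.-integrable setT (EFin \o (S \* e)%R).
  exact: square_integrable_mul.
have [iSeD SeD] : P.-integrable setT (fun w => ((S \* e)%R w * D w)%:E) /\
    \int[P]_w ((S \* e)%R w * D w)%:E =
    \int[P]_w ((S \* e)%R w)%:E * \int[P]_w (D w)%:E.
  apply: independent_expectation_mul => //.
  - exact: measurable_funM.
  - apply: wiener_increment_independent => //.
    exact: (measurable_wrtM (filtration_sigma hF s0)).
  - exact: square_integrable_integrable.
rewrite wiener_increment_mean// ?mule0 in SeD; last exact: ltW.
have [ieD eD] : P.-integrable setT (fun w => (e w ^+ 2 * D w ^+ 2)%:E) /\
    \int[P]_w (e w ^+ 2 * D w ^+ 2)%:E =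
    \int[P]_w (e w ^+ 2)%:E * \int[P]_w (D w ^+ 2)%:E.
  apply: (@independent_expectation_mul _ _ _ _ (fun w => e w ^+ 2)%R (fun w => D w ^+ 2)%R).
  - exact: measurable_funX.
  - exact: measurable_funX.
  - apply: (independent_rv_comp (f := fun x : R => (x ^+ 2)%R)
      (g := fun x : R => (x ^+ 2)%R)); [exact: measurable_funX..|].
    exact: wiener_increment_independent.
  - exact: square_integrable_sqr.
  - exact: square_integrable_sqr.
rewrite wiener_increment_sqr// in eD; last exact: ltW.
have S'2 w : (S' w ^+ 2)%:E =
    (S w ^+ 2)%:E + (2%:E * ((S \* e)%R w * D w)%:E + (e w ^+ 2 * D w ^+ 2)%:E).
  by rewrite -EFinM -!EFinD; congr EFin; rewrite /S' /D/=; ring.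
have i2 : P.-integrable setT (fun w => 2%:E * ((S \* e)%R w * D w)%:E).
  exact: integrableZl.
have ES' : \int[P]_w (S' w ^+ 2)%:E =
    \int[P]_w (S w ^+ 2)%:E + \int[P]_w (e w ^+ 2)%:E * (t - s)%:E.
  under eq_integral do rewrite S'2.
  rewrite integralD//; last 2 first.
  - exact: square_integrable_sqr.
  - exact: integrableD.
  by rewrite integralD// integralZl// SeD mule0 add0e eD.
split=> //; split=> //.
rewrite ES' lte_add_pinfty//; first by case: sS.
by rewrite lte_mul_pinfty ?lee_fin ?subr_ge0 ?(ltW st)// ?lte_fin ?ltry//;
  [exact: integral_sqr_ge0|rewrite ge0_fin_numE ?integral_sqr_ge0//; case: se].
Qed.

Variables (N : nat) (tau : nat -> R) (e : nat -> Om -> R).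
Hypothesis tau0 : (0 <= tau 0)%R.
Hypothesis tau_nd : forall i, (i < N)%N -> (tau i <= tau i.+1)%R.
Hypothesis se : forall i, (i < N)%N -> square_integrable P (e i).
(** The times will be those of a simple process clamped to an interval [[a, b]]. Clamping can move
    [tau i] before the time at which [e i] is known, but only when the whole interval collapses;
    hence the second alternative. *)
Hypothesis me : forall i, (i < N)%N ->
  measurable_wrt (F (tau i)) (e i) \/ tau i = tau i.+1.

Let tau_ge0 n : (n <= N)%N -> (0 <= tau n)%R.
Proof.
elim: n => [//|n ih] nN.
by rewrite (le_trans (ih (ltnW nN)))// tau_nd.
Qed.

Let S n w : R := (\sum_(i < n) e i w * (W (tau i.+1) w - W (tau i) w))%R.

Let simple_integral_sqr n : (n <= N)%N ->
  [/\ measurable_wrt (F (tau n)) (S n), square_integrable P (S n) &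
  \int[P]_w (S n w ^+ 2)%:E =
  (\sum_(i < n) \int[P]_w (e i w ^+ 2)%:E * (tau i.+1 - tau i)%:E)].
Proof.
elim: n => [_|n ih nN].
  have -> : S 0 = cst 0%R by apply/funext => w; rewrite /S big_ord0.
  split.
  - exact: (measurable_wrt_cst (filtration_sigma hF tau0)).
  - exact: square_integrable_cst.
  - by rewrite big_ord0 integral0_eq// => w _; rewrite expr0n.
have [mS sS SE] := ih (ltnW nN).
have SS w : S n.+1 w = (S n w + e n w * (W (tau n.+1) w - W (tau n) w))%R.
  by rewrite /S big_ord_recr.
rewrite (_ : S n.+1 = fun w => S n w + e n w * (W (tau n.+1) w - W (tau n) w))%R;
  last exact/funext.
rewrite big_ord_recr/= -SE.
case: (me nN) => [men|tt].
  by apply: simple_isometry_step => //;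
    [exact/tau_ge0/ltnW|exact: tau_nd|exact: se].
rewrite -tt; under eq_fun do rewrite subrr mulr0 addr0.
split=> //; rewrite subrr mule0 adde0.
by apply: eq_integral => w _; rewrite subrr mulr0 addr0.
Qed.

Lemma simple_integral_square_integrable : square_integrable P (S N).
Proof. by have [] := simple_integral_sqr (leqnn N). Qed.

Let V n (z : Om * R) : R :=
  (\sum_(i < n) e i z.1 * \1_(`]tau i, tau i.+1]) z.2)%R.

Let tau_le n i : (n <= N)%N -> (i <= n)%N -> (tau i <= tau n)%R.
Proof.
elim: n => [|n ih] nN; first by rewrite leqn0 => /eqP->.
rewrite leq_eqVlt => /predU1P[->//|]; rewrite ltnS => ni.
by rewrite (le_trans (ih (ltnW nN) ni))// tau_nd.
Qed.

(** The intervals are disjoint. This kills the cross term in the square of the integrand, as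
    independence does for the integral. *)
Let VV n z : (n < N)%N -> (V n z * \1_(`]tau n, tau n.+1]) z.2 = 0)%R.
Proof.
move=> nN; rewrite /V mulr_suml big1// => i _; rewrite -mulrA.
rewrite [X in (_ * X)%R](_ : _ = 0%R) ?mulr0//.
rewrite !indicE !mem_setE !in_itv/=.
have [nz|] := ltP (tau n) z.2; last by rewrite mulr0.
have : (tau i.+1 <= tau n)%R by apply: tau_le => //; exact: ltnW.
by case: (leP z.2 (tau i.+1)) => h1 h2; rewrite ?andbF ?mul0r//; lra.
Qed.

Lemma measurable_simple_integrand n : (n <= N)%N -> measurable_fun setT (V n).
Proof.
move=> nN; apply: measurable_sum => i; apply: measurable_funM.
  have [mei _] := se (leq_trans (ltn_ord i) nN).
  exact: measurableT_comp.
by apply: measurableT_comp => //; exact: measurable_indic.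
Qed.

(** The right-hand side is the sum found in [simple_integral_sqr], so that the isometry becomes a
    comparison of two closed forms. *)
Lemma simple_integrand_sqr n : (n <= N)%N ->
  \int[P \x lebesgue_measure]_z (V n z ^+ 2)%:E =
  (\sum_(i < n) \int[P]_w (e i w ^+ 2)%:E * (tau i.+1 - tau i)%:E).
Proof.
elim: n => [_|n ih nN].
  by rewrite big_ord0; apply: integral0_eq => z _; rewrite /V big_ord0 expr0n.
have mVn := measurable_simple_integrand (ltnW nN).
have [men _] := se nN.
have me2 : measurable_fun [set: Om * measurableTypeR R]
    (fun z => (e n z.1 ^+ 2 * \1_(`]tau n, tau n.+1]) z.2)%:E).
  apply/measurable_EFinP; apply: measurable_funM.
    by apply: measurable_funX; exact: measurableT_comp.
  by apply: measurableT_comp => //; exact: measurable_indic.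
rewrite big_ord_recr/= -(ih (ltnW nN)).
transitivity (\int[P \x lebesgue_measure]_z ((V n z ^+ 2)%:E +
    (e n z.1 ^+ 2 * \1_(`]tau n, tau n.+1]) z.2)%:E)).
  apply: eq_integral => z _; rewrite -EFinD; congr EFin.
  have -> : V n.+1 z = (V n z + e n z.1 * \1_(`]tau n, tau n.+1]) z.2)%R.
    by rewrite /V big_ord_recr.
  rewrite sqrrD [(V n z * _)%R]mulrCA VV// mulr0 mul0rn addr0 exprMn.
  by congr (_ + _ * _)%R; rewrite indicE; case: (_ \in _); rewrite ?expr0n ?expr1n.
rewrite ge0_integralD//; last 3 first.
- by move=> z _; rewrite lee_fin sqr_ge0.
- exact: measurable_sqrE.
- by move=> z _; rewrite lee_fin mulr_ge0// sqr_ge0.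
congr (_ + _); rewrite fubini_tonelli1//; last first.
  by move=> z; rewrite lee_fin mulr_ge0// sqr_ge0.
rewrite /fubini_F/= -ge0_integralZr//; last 3 first.
- exact: measurable_sqrE.
- by move=> z _; rewrite lee_fin sqr_ge0.
- by rewrite lee_fin subr_ge0 tau_nd.
apply: eq_integral => w _.
under eq_integral do rewrite EFinM.
rewrite ge0_integralZl//; last 2 first.
- by apply/measurable_EFinP; exact: measurable_indic.
- by rewrite lee_fin sqr_ge0.
rewrite integral_indic//= setIT lebesgue_measure_itv/= lte_fin.
case: ltP => //= h; congr (_ * _%:E).
by have := tau_nd nN; lra.
Qed.

Lemma simple_isometry :
  \int[P]_w (S N w ^+ 2)%:E = \int[P \x lebesgue_measure]_z (V N z ^+ 2)%:E.
Proof.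
by rewrite simple_integrand_sqr//; have [] := simple_integral_sqr (leqnn N).
Qed.

End simple_isometry.

Lemma lebesgue_measure_itv_oc (R : realType) (a b : R) : a <= b ->
  lebesgue_measure `]a, b]%classic = (b - a)%:E.
Proof.
move=> ab; rewrite lebesgue_measure_itv/= lte_fin; case: ltP => //= ba.
by rewrite (_ : b = a) ?subrr//; apply/eqP; rewrite eq_le ab ba.
Qed.

Lemma cvge0_le (R : realType) (u v : nat -> \bar R) :
  (forall n, 0 <= u n <= v n)%E ->
  (v n @[n --> \oo] --> 0)%E -> (u n @[n --> \oo] --> 0)%E.
Proof.
move=> uv cv; apply: (@squeeze_cvge _ _ _ R (cst 0%E) u v _ 0%E) => //.
- exact: nearW.
- exact: cvg_cst.
Qed.

(** * Progressively measurable processes on the product space *)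

Section progressive.
Context d (Om : measurableType d) (R : realType) (P : probability Om R).
Variables (F : R -> set (set Om)) (T : R).
Hypotheses (hF : complete_filtration P F) (T0 : 0 <= T).

(** At the final time [T], the sigma-algebra of progressive measurability is contained in the
    product one. The indicator gives a function on the whole product, whatever [X] does outside
    [[0, T]]; the coordinates are swapped to match [P \x lebesgue_measure]. *)
Lemma progressively_measurable_prod (X : R -> Om -> R) :
  progressively_measurable F T X ->
  measurable_fun [set: Om * R] (fun z => \1_(`[0, T]) z.2 * X z.2 z.1).
Proof.
move=> hX.
have sub : <<s `[0, T] `*` setT,
        [set C | exists (A : set R) (B : set Om), [/\ measurable A, A `<=` `[0, T], F T B
                               & C = A `*` B]] >> `<=` @measurable _ (R * Om)%type.
  apply: smallest_sub.
    split=> [|A mA|A mA]; first exact: measurable0.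
      by apply: measurableD => //; exact: measurableX.
    exact: bigcupT_measurable.
  move=> _ [A [B [mA _ FB ->]]]; apply: measurableX => //.
  exact: (filtration_sub hF T0 FB).
suff mX : measurable_fun [set: R * Om] (fun p => \1_(`[0, T]) p.1 * X p.1 p.2).
  exact: (measurableT_comp mX (@measurable_swap _ _ _ _)).
move=> _ Y mY; rewrite setTI.
(* Outside [[0, T]] the function is 0, so the preimage contains all or nothing there, according to
   whether 0 belongs to [Y]. *)
have -> : (fun p : R * Om => \1_(`[0, T]) p.1 * X p.1 p.2) @^-1` Y =
    [set p : R * Om | p.1 \in `[0, T] /\ Y (X p.1 p.2)] `|`
    ((~` `[0, T] `*` [set: Om]) `&` (if `[< Y 0 >] then setT else set0)).
  apply/seteqP; split => -[s w] /=; rewrite indicE mem_setE.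
    case: (boolP (s \in `[0, T])) => sT; rewrite ?mul1r ?mul0r => Ys; first by left.
    by right; split; [split=> //; exact/negP|rewrite asboolT].
  case=> [[-> Ys]|[[/negP/negbTE-> _]]]; first by rewrite mul1r.
  by case: asboolP => //; rewrite mul0r.
apply: measurableU.
  by apply: sub; apply: hX => //; rewrite T0 lexx.
apply: measurableI; last by case: ifP.
by apply: measurableX => //; exact: measurableC.
Qed.

Local Open Scope ereal_scope.

Lemma progressively_measurable_itv (X : R -> Om -> R) (a b : R) :
  progressively_measurable F T X -> (0 <= a)%R -> (b <= T)%R ->
  measurable_fun [set: Om * R] (fun z => \1_(`]a, b]) z.2 * X z.2 z.1)%R.
Proof.
move=> hX a0 bT; have := progressively_measurable_prod hX => mX.
have -> : (fun z : Om * R => \1_(`]a, b]) z.2 * X z.2 z.1)%R =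
    (fun z => \1_(`]a, b]) z.2 * (\1_(`[0%R, T]) z.2 * X z.2 z.1))%R.
  apply/funext => z; rewrite !indicE !mem_setE !in_itv/=.
  case: (boolP ((a < z.2)%R && _)) => [/andP[az zb]|]; rewrite ?mul0r// !mul1r.
  by rewrite (ltW (le_lt_trans a0 az)) (le_trans zb bT) mul1r.
apply: measurable_funM => //.
by apply: measurableT_comp => //; exact: measurable_indic.
Qed.

Lemma integral_prod_itv (h : R -> Om -> R) (J : interval R) :
  measurable_fun [set: Om * R] (fun z => \1_[set` J] z.2 * h z.2 z.1)%R ->
  \int[P]_w \int[lebesgue_measure]_(s in [set` J]) (h s w ^+ 2)%:E =
  \int[P \x lebesgue_measure]_z ((\1_[set` J] z.2 * h z.2 z.1) ^+ 2)%:E.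
Proof.
move=> mh; rewrite fubini_tonelli1; first last.
- by move=> z; rewrite lee_fin sqr_ge0.
- exact: measurable_sqrE.
apply: eq_integral => w _; rewrite integral_mkcond; apply: eq_integral => s _.
rewrite patchE indicE; case: ifPn => _; rewrite ?mul1r ?mul0r//.
by rewrite expr0n.
Qed.

Lemma integral_prod_itv_expectation (h : R -> Om -> R) (J : interval R) :
  measurable_fun [set: Om * R] (fun z => \1_[set` J] z.2 * h z.2 z.1)%R ->
  \int[P \x lebesgue_measure]_z ((\1_[set` J] z.2 * h z.2 z.1) ^+ 2)%:E =
  \int[lebesgue_measure]_(s in [set` J]) \int[P]_w (h s w ^+ 2)%:E.
Proof.
move=> mh; rewrite fubini_tonelli2; first last.
- by move=> z; rewrite lee_fin sqr_ge0.
- exact: measurable_sqrE.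
rewrite [RHS]integral_mkcond; apply: eq_integral => s _.
rewrite patchE /fubini_G/= indicE; case: ifPn => _.
  by under eq_integral do rewrite mul1r.
by apply: integral0_eq => w _; rewrite mul0r expr0n.
Qed.

Lemma le_integral_prod_itv (h : R -> Om -> R) (a b c : R) : (a <= b)%R ->
  measurable_fun [set: Om * R] (fun z => \1_(`]a, b]) z.2 * h z.2 z.1)%R ->
  (forall s, (a < s <= b)%R -> \int[P]_w (h s w ^+ 2)%:E <= c%:E) ->
  \int[P \x lebesgue_measure]_z ((\1_(`]a, b]) z.2 * h z.2 z.1) ^+ 2)%:E
  <= (c * (b - a))%:E.
Proof.
move=> ab mh hc; rewrite integral_prod_itv_expectation//.
apply: (@le_trans _ _ (\int[lebesgue_measure]_(s in `]a, b]) c%:E)).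
  apply: ge0_le_integral => //.
  - by move=> s _; exact: integral_sqr_ge0.
  - have mG := measurable_fun_fubini_tonelli_G (m1 := P)
      (fun z => ((\1_(`]a, b]) z.2 * h z.2 z.1) ^+ 2)%:E)
      (measurable_sqrE mh).
    apply: (eq_measurable_fun (fubini_G P
      (fun z => ((\1_(`]a, b]) z.2 * h z.2 z.1) ^+ 2)%:E))).
      move=> s; rewrite /fubini_G/= indicE => ->.
      by under eq_integral do rewrite mul1r.
    apply: measurable_funTS; apply: mG => z; by rewrite lee_fin sqr_ge0.
by rewrite integral_cst//= lebesgue_measure_itv_oc.
Qed.

Lemma ge_integral_prod_itv (h : R -> Om -> R) (a b c : R) : (a <= b)%R ->
  measurable_fun [set: Om * R] (fun z => \1_(`]a, b]) z.2 * h z.2 z.1)%R ->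
  (forall s, (a < s <= b)%R -> c%:E <= \int[P]_w (h s w ^+ 2)%:E) ->
  (c * (b - a))%:E <=
  \int[P \x lebesgue_measure]_z ((\1_(`]a, b]) z.2 * h z.2 z.1) ^+ 2)%:E.
Proof.
move=> ab mh hc.
have [c0|c0] := leP c 0%R.
  by apply: (le_trans _ (integral_sqr_ge0 _ _)); rewrite lee_fin; nra.
rewrite integral_prod_itv_expectation//.
apply: (@le_trans _ _ (\int[lebesgue_measure]_(s in `]a, b]) c%:E)).
  by rewrite integral_cst//= lebesgue_measure_itv_oc.
apply: ge0_le_integral => //.
- by move=> s _; rewrite lee_fin ltW.
- have mG := measurable_fun_fubini_tonelli_G (m1 := P)
    (fun z => ((\1_(`]a, b]) z.2 * h z.2 z.1) ^+ 2)%:E)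
    (measurable_sqrE mh).
  apply: (eq_measurable_fun (fubini_G P
    (fun z => ((\1_(`]a, b]) z.2 * h z.2 z.1) ^+ 2)%:E))).
    move=> s; rewrite /fubini_G/= indicE => ->.
    by under eq_integral do rewrite mul1r.
  by apply: measurable_funTS; apply: mG => z; rewrite lee_fin sqr_ge0.
Qed.

End progressive.

(** * The isometry for increments of the Ito integral *)

Section ito_isometry.
Context d (Om : measurableType d) (R : realType) (P : probability Om R).
Variables (F : R -> set (set Om)) (W : R -> Om -> R) (T : R).
Hypotheses (hF : complete_filtration P F) (hW : wiener_process P F W).
Hypothesis T0 : 0 <= T.

(** Applied to Wiener paths, it shows that the increment of a simple integral between [a] and [b] is
    again a simple integral, with the same coefficients and with times clamped to [[a, b]]. *)
Lemma clamp_increment (u : R -> R) (a b x : R) : a <= b ->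
  u (Num.min x b) - u (Num.min x a) = u (Num.max a (Num.min x b)) - u a.
Proof.
move=> ab; have [xa|ax] := leP x a.
  by rewrite min_l ?(le_trans xa ab)// max_l ?subrr// min_l// subrr.
by rewrite max_r// le_min (ltW ax).
Qed.

Section simple.
Variables (phi : simple_process F T) (a b : R).
Hypotheses (a0 : 0 <= a) (ab : a <= b) (bT : b <= T).

Let tau i := Num.max a (Num.min (sp_time phi i) b).

Let sp_time_ge i : (i <= sp_size phi)%N -> 0 <= sp_time phi i.
Proof.
elim: i => [_|i ih iN]; first exact: sp_time_ge0.
by rewrite (le_trans (ih (ltnW iN)))// sp_time_nondecreasing.
Qed.

Let tau0 : 0 <= tau 0. Proof. by rewrite /tau le_max a0. Qed.

Let tau_nd i : (i < sp_size phi)%N -> tau i <= tau i.+1.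
Proof.
move=> iN; rewrite /tau ge_max le_max lexx/= le_max.
by rewrite le_min !ge_min lexx orbT sp_time_nondecreasing// orbT.
Qed.

Let square_integrable_coef i : (i < sp_size phi)%N ->
  square_integrable P (sp_coef phi i).
Proof.
move=> iN; have [M hM] := sp_coef_bounded iN.
have mc : measurable_fun setT (sp_coef phi i).
  apply: (filtration_measurable hF (sp_time_ge (ltnW iN))).
  exact: sp_coef_measurable.
split=> //; apply: (@le_lt_trans _ _ (\int[P]_w (M ^+ 2)%:E)%E).
  apply: ge0_le_integral => //.
  - by move=> w _; rewrite lee_fin sqr_ge0.
  - exact: measurable_sqrE.
  - move=> w _; rewrite lee_fin -(real_normK (num_real (sp_coef phi i w))).
    by rewrite lerXn2r ?nnegrE// (le_trans _ (hM w)).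
by have [] := square_integrable_cst P M.
Qed.

Let coef_wrt i : (i < sp_size phi)%N ->
  measurable_wrt (F (tau i)) (sp_coef phi i) \/ tau i = tau i.+1.
Proof.
move=> iN; have [tb|bt] := leP (sp_time phi i) b.
  left; apply: measurable_wrt_subset (sp_coef_measurable iN).
  apply: (filtration_nondecreasing hF); first exact: sp_time_ge (ltnW iN).
  by rewrite /tau min_l// le_max lexx orbT.
right; rewrite /tau !min_r//; last exact: ltW.
by rewrite (le_trans (ltW bt))// sp_time_nondecreasing.
Qed.

Let sp_integralE w : sp_integral W phi b w - sp_integral W phi a w =
  \sum_(i < sp_size phi) sp_coef phi i w * (W (tau i.+1) w - W (tau i) w).
Proof.
rewrite /sp_integral -sumrB; apply: eq_bigr => i _; rewrite -mulrBr; congr (_ * _).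
have h x := clamp_increment (W ^~ w) x ab.
have := h (sp_time phi i.+1); have := h (sp_time phi i); rewrite /tau.
by lra.
Qed.

(** Intersecting with []a, b]] clamps the ends of each interval exactly as in [sp_integralE], even
    when the intersection is empty; both sides of the isometry thus involve the same times. *)
Let sp_valE (z : Om * R) : \1_(`]a, b]) z.2 * sp_val phi z.2 z.1 =
  \sum_(i < sp_size phi) sp_coef phi i z.1 * \1_(`]tau i, tau i.+1]) z.2.
Proof.
rewrite /sp_val mulr_sumr; apply: eq_bigr => i _; rewrite mulrCA; congr (_ * _).
rewrite !indicE !mem_setE !in_itv/= -natrM mulnb; congr (_%:R); congr nat_of_bool.
rewrite /tau gt_max le_max le_min gt_min.
rewrite (ltNge b) (leNgt z.2 a).
by case: (a < z.2); case: (z.2 <= b); case: (sp_time phi i < z.2);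
  case: (z.2 <= sp_time phi i.+1).
Qed.

Lemma sp_integral0 w : sp_integral W phi 0 w = 0.
Proof.
rewrite /sp_integral big1// => i _.
by rewrite !min_r ?subrr ?mulr0// sp_time_ge// ltnW.
Qed.

(** Reconciles the closed interval [[0, T]] of the approximation property with the half-open
    intervals of the isometry. *)
Lemma sp_val0 w : sp_val phi 0 w = 0.
Proof.
rewrite /sp_val big1// => i _; rewrite indicE mem_setE in_itv/=.
by rewrite ltNge sp_time_ge ?mulr0// ltnW.
Qed.

Lemma measurable_sp_val :
  measurable_fun [set: Om * R] (fun z => \1_(`]a, b]) z.2 * sp_val phi z.2 z.1).
Proof.
apply: (eq_measurable_fun (fun z : Om * R =>
  \sum_(i < sp_size phi) sp_coef phi i z.1 * \1_(`]tau i, tau i.+1]) z.2)).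
  by move=> z _; rewrite sp_valE.
exact: (measurable_simple_integrand tau square_integrable_coef).
Qed.

Lemma square_integrable_sp_integral :
  square_integrable P (fun w => sp_integral W phi b w - sp_integral W phi a w).
Proof.
rewrite (_ : (fun w => _) = fun w => \sum_(i < sp_size phi)
    sp_coef phi i w * (W (tau i.+1) w - W (tau i) w)); last first.
  by apply/funext => w; exact: sp_integralE.
exact: (simple_integral_square_integrable hF hW tau0 tau_nd square_integrable_coef coef_wrt).
Qed.

Lemma sp_integral_isometry :
  (\int[P]_w ((sp_integral W phi b w - sp_integral W phi a w) ^+ 2)%:E =
  \int[P \x lebesgue_measure]_z
    ((\1_(`]a, b]) z.2 * sp_val phi z.2 z.1) ^+ 2)%:E)%E.
Proof.
under eq_integral do rewrite sp_integralE.
under [RHS]eq_integral do rewrite sp_valE.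
exact: (simple_isometry hF hW tau0 tau_nd square_integrable_coef coef_wrt).
Qed.

End simple.

Variables g I : R -> Om -> R.
Hypothesis hI : ito_integral P F W T g I.

Lemma measurable_ito (t : R) : 0 <= t <= T -> measurable_fun setT (I t).
Proof.
move=> tT; have [t0 _] := andP tT.
by apply: (filtration_measurable hF t0); exact: (ito_adapted hI).
Qed.

Local Open Scope ereal_scope.

(** Passage to the limit in the simple isometry. The integrals converge at the two times [a] and
    [b], hence so do the increments; the integrands converge on [[0, T]], hence on the smaller []a,
    b]]. *)
Lemma ito_isometry (a b : R) : (0 <= a)%R -> (a <= b)%R -> (b <= T)%R ->
  \int[P]_w ((I b w - I a w) ^+ 2)%:E =
  \int[P \x lebesgue_measure]_z ((\1_(`]a, b]) z.2 * g z.2 z.1) ^+ 2)%:E.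
Proof.
move=> a0 ab bT.
have mIb : measurable_fun setT (I b) by apply: measurable_ito; rewrite (le_trans a0 ab).
have mIa : measurable_fun setT (I a) by apply: measurable_ito; rewrite a0 (le_trans ab bT).
have mg := progressively_measurable_itv hF T0 (ito_integrand_progressive hI) a0 bT.
have [phi [cg cI]] := ito_limit hI.
have mgT := progressively_measurable_prod hF T0 (ito_integrand_progressive hI).
have sqn n := square_integrable_sp_integral (phi n) a0 ab.
apply: (eq_integral_sqr_limit
  (u_ := fun n w => (sp_integral W (phi n) b w - sp_integral W (phi n) a w)%R)
  (u := fun w => (I b w - I a w)%R)
  (v_ := fun n (z : Om * measurableTypeR R) =>
    (\1_(`]a, b]) z.2 * sp_val (phi n) z.2 z.1)%R)
  (v := fun z : Om * measurableTypeR R => (\1_(`]a, b]) z.2 * g z.2 z.1)%R)).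
- by move=> n; have [] := sqn n.
- exact: measurable_funB.
- by move=> n; exact: measurable_sp_val.
- exact: mg.
- by move=> n; exact: sp_integral_isometry.
- have mS t n : (0 <= t <= T)%R ->
      measurable_fun setT (fun w => sp_integral W (phi n) t w - I t w)%R.
    move=> tT; have [t0 _] := andP tT.
    apply: measurable_funB; last exact: measurable_ito.
    have [+ _] := square_integrable_sp_integral (phi n) (lexx 0%R) t0.
    by under eq_fun do rewrite sp_integral0 subr0.
  have cb : 'E_P[fun w => ((sp_integral W (phi n) b w - I b w) ^+ 2)%R]
      @[n --> \oo] --> 0 by apply: cI; rewrite (le_trans a0 ab).
  have ca : 'E_P[fun w => ((sp_integral W (phi n) a w - I a w) ^+ 2)%R]
      @[n --> \oo] --> 0 by apply: cI; rewrite a0 (le_trans ab).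
  (* The bound [(x - y) ^ 2 <= 2 x ^ 2 + 2 y ^ 2], with its constants in the shape that
     [integral_sqrD_le] gives at [e = 1]. *)
  have c0 : (1 + 1)%:E * 'E_P[fun w => ((sp_integral W (phi n) b w - I b w) ^+ 2)%R] +
    (1 + 1^-1)%:E * 'E_P[fun w => ((sp_integral W (phi n) a w - I a w) ^+ 2)%R]
      @[n --> \oo] --> 0.
    rewrite [X in _ --> X](_ : _ = (1 + 1)%:E * 0 + (1 + 1^-1)%:E * 0); last first.
      by rewrite !mule0 adde0.
    by apply: cvgeD; [rewrite !mule0|exact: cvgeZl|exact: cvgeZl].
  apply: cvge0_le c0 => n.
  rewrite integral_sqr_ge0/= unlock.
  have h : (\int[P]_w ((sp_integral W (phi n) a w - I a w) ^+ 2)%:E =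
     \int[P]_w ((- (sp_integral W (phi n) a w - I a w)) ^+ 2)%:E).
    by apply: eq_integral => w _; rewrite sqrrN.
  have aT : (0 <= a <= T)%R by rewrite a0 (le_trans ab).
  have bT' : (0 <= b <= T)%R by rewrite bT (le_trans a0).
  have mNa : measurable_fun setT (\- (fun w => sp_integral W (phi n) a w - I a w))%R.
    by apply: measurableT_comp => //; exact: mS.
  rewrite h; apply: (le_trans _ (integral_sqrD_le P ltr01 (mS b n bT') mNa)).
  apply: ge0_le_integral => //.
  + by move=> w _; rewrite lee_fin sqr_ge0.
  + apply: measurable_sqrE; apply: measurable_funB; last exact: measurable_funB.
    by have [] := sqn n.
  + by apply: measurable_sqrE; apply: measurable_funD mNa; exact: mS.
  + move=> w _; rewrite lee_fin le_eqVlt; apply/orP; left; apply/eqP => /=.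
    by congr (_ ^+ 2)%R; ring.
- have mdT n : measurable_fun [set: Om * R]
      (fun z => \1_(`[0%R, T]) z.2 * (sp_val (phi n) z.2 z.1 - g z.2 z.1))%R.
    have mn := measurable_sp_val (phi n) 0%R T.
    apply: eq_measurable_fun (measurable_funB mn mgT) => -[w s] _ /=.
    rewrite mulrBr; congr (_ - _)%R.
    rewrite !indicE !mem_setE !in_itv/=.
    by case: ltgtP => // <-; rewrite sp_val0 !mulr0.
  apply: cvge0_le cg => n.
  rewrite integral_sqr_ge0/= 
    (@integral_prod_itv _ _ _ P (fun s w => sp_val (phi n) s w - g s w)%R _ (mdT n)).
  apply: ge0_le_integral => //.
  + by move=> w _; rewrite lee_fin sqr_ge0.
  + apply: measurable_sqrE; apply: measurable_funB; last exact: mg.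
    exact: measurable_sp_val.
  + exact: (measurable_sqrE (mdT n)).
  + move=> -[w s] _; rewrite lee_fin /= -mulrBr !exprMn.
    apply: ler_wpM2r; first exact: sqr_ge0.
    rewrite !indicE !mem_setE !in_itv/=.
    case: (boolP ((a < s)%R && _)) => [/andP[as_ sb]|_]; last by rewrite expr0n sqr_ge0.
    by rewrite (ltW (le_lt_trans a0 as_)) (le_trans sb bT).
Qed.

End ito_isometry.

(** * Expansion of the covariance *)

(** Cauchy-Schwarz against the constant 1, obtained by integrating [(f s - c) ^+ 2 >= 0] where [c]
    is the mean of [f] over the interval. *)
Lemma sqr_Rintegral_le (R : realType) (f : R -> R) (a b : R) : a <= b ->
  lebesgue_measure.-integrable `]a, b] (EFin \o f) ->
  (((\int[lebesgue_measure]_(s in `]a, b]) f s) ^+ 2)%:E <=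
  (b - a)%:E * \int[lebesgue_measure]_(s in `]a, b]) (f s ^+ 2)%:E)%E.
Proof.
rewrite le_eqVlt => /predU1P[<-|ab] fi.
  by rewrite set_itvoc0 Rintegral_set0 integral_set0 expr0n mule0.
have [mf _] := integrableP _ _ _ fi; move/measurable_EFinP in mf.
have mf2 : measurable_fun `]a, b]%classic (fun s => (f s ^+ 2)%:E).
  by apply/measurable_EFinP; exact: measurable_funX.
have r0 : 0 < b - a by rewrite subr_gt0.
have [->|] := eqVneq (\int[lebesgue_measure]_(s in `]a, b]) (f s ^+ 2)%:E)%E +oo%E.
  by rewrite gt0_muley ?lte_fin// leey.
rewrite -ltey => f2.
have f2i : lebesgue_measure.-integrable `]a, b] (EFin \o (fun s => f s ^+ 2)).
  apply/integrableP; split=> //.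
  by under eq_integral do rewrite gee0_abs ?lee_fin ?sqr_ge0//.
set D := \int[lebesgue_measure]_(s in `]a, b]) f s.
pose c := D / (b - a).
have ci (k : R) : lebesgue_measure.-integrable `]a, b] (EFin \o cst k).
  apply/integrableP; split; first exact/measurable_EFinP/measurable_cst.
  under eq_integral do rewrite /=.
  rewrite integral_cst//= lebesgue_measure_itv_oc ?(ltW ab)//.
  by rewrite -EFinM ltry.
have i1 : lebesgue_measure.-integrable `]a, b] (EFin \o (fun s => 2 * c * f s)).
  exact: (integrableZl _ (2 * c) fi).
have i2 : lebesgue_measure.-integrable `]a, b] (EFin \o (fun s => f s ^+ 2 + cst (c ^+ 2) s)).
  exact: (integrableD _ f2i (ci _)).
have : \int[lebesgue_measure]_(s in `]a, b]) (2 * c * f s) <=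
    \int[lebesgue_measure]_(s in `]a, b]) (f s ^+ 2 + cst (c ^+ 2) s).
  apply: le_Rintegral => // s _ /=; rewrite -subr_ge0.
  rewrite (_ : _ - _ = (f s - c) ^+ 2) ?sqr_ge0//.
  by ring.
rewrite RintegralZl// RintegralD// Rintegral_cst//= lebesgue_measure_itv_oc ?(ltW ab)//=.
rewrite -/D => h.
have -> : (\int[lebesgue_measure]_(s in `]a, b]) (f s ^+ 2)%:E)%E =
    (\int[lebesgue_measure]_(s in `]a, b]) (f s ^+ 2))%:E.
  by rewrite /Rintegral fineK//; exact: integrable_fin_num f2i.
rewrite -EFinM lee_fin.
move: h; set J := Rintegral _ _ _ => h.
have Dc : D = c * (b - a) by rewrite /c divfK// gt_eqF.
rewrite Dc in h *.
have : c ^+ 2 * (b - a) <= J by nra.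
by move=> h'; rewrite exprMn; nra.
Qed.

Section drift.
Context d (Om : measurableType d) (R : realType) (P : probability Om R).
Variables (F : R -> set (set Om)) (W : R -> Om -> R) (T : R).
Variables (f g V : R -> Om -> R) (M : R).
Hypotheses (hF : complete_filtration P F).
Hypothesis T0 : 0 <= T.
Hypothesis hV : ito_process P F W T f g V.
Hypothesis hf : forall t : R, 0 <= t <= T -> ('E_P[fun w => (f t w ^+ 2)%R] < M%:E)%E.

Lemma measurable_ito_process (t : R) : 0 <= t <= T -> measurable_fun setT (V t).
Proof.
move=> tT; have [t0 _] := andP tT.
by apply: (filtration_measurable hF t0); exact: (ito_process_adapted hV).
Qed.

(** The difference of the two increments is almost surely the integral of [f] over []a, b]].
    Cauchy-Schwarz in time yields one factor [b - a], and Tonelli with the bound [M] on second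
    moments yields the other. *)
Lemma ito_process_drift_bound : exists I : R -> Om -> R, ito_integral P F W T g I /\
  forall a b : R, 0 <= a -> a <= b -> b <= T ->
  (\int[P]_w (((V b w - V a w) - (I b w - I a w)) ^+ 2)%:E <=
   (M * (b - a) ^+ 2)%:E)%E.
Proof.
have [I [hI eqI]] := ito_process_eq hV.
exists I; split=> // a b a0 ab bT.
have aT : 0 <= a <= T by rewrite a0 (le_trans ab).
have bT' : 0 <= b <= T by rewrite bT (le_trans a0).
have mf := progressively_measurable_itv hF T0 (ito_process_drift hV) a0 bT.
pose Q w : \bar R := (\int[lebesgue_measure]_(s in `]a, b]) (f s w ^+ 2)%:E)%E.
have Q0 w : (0 <= Q w)%E by apply: integral_ge0 => s _; rewrite lee_fin sqr_ge0.
have mQ : measurable_fun setT Q.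
  have mF := measurable_fun_fubini_tonelli_F (m2 := lebesgue_measure)
    (fun z : Om * measurableTypeR R => ((\1_(`]a, b]) z.2 * f z.2 z.1) ^+ 2)%:E)
    (measurable_sqrE mf).
  apply: (eq_measurable_fun (fubini_F lebesgue_measure
    (fun z : Om * measurableTypeR R => ((\1_(`]a, b]) z.2 * f z.2 z.1) ^+ 2)%:E))).
    move=> w _; rewrite /fubini_F /Q [RHS]integral_mkcond; apply: eq_integral => s _.
    by rewrite patchE/= indicE; case: ifPn => _; rewrite ?mul1r ?mul0r ?expr0n.
  by apply: mF => z; rewrite lee_fin sqr_ge0.
apply: (@le_trans _ _ (\int[P]_w ((b - a)%:E * Q w))%E).
  apply: ae_ge0_le_integral => //.
  - by move=> w _; rewrite lee_fin sqr_ge0.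
  - apply: measurable_sqrE; apply: measurable_funB.
      by apply: measurable_funB; exact: measurable_ito_process.
    by apply: measurable_funB; exact: (measurable_ito hF hI).
  - by move=> w _; rewrite mule_ge0// lee_fin subr_ge0.
  - exact: measurable_funeM.
  - have fi := ito_process_drift_integrable hV.
    apply: filterS2 fi eqI => w fi eqw _.
    have ib : lebesgue_measure.-integrable `[0, b] (EFin \o f ^~ w).
      apply: integrableS fi => //; apply: subset_itvl; by rewrite bnd_simp.
    have -> : V b w - V a w - (I b w - I a w) =
        \int[lebesgue_measure]_(s in `]a, b]) f s w.
      rewrite (eqw _ aT) (eqw _ bT') -(Rintegral_itvB ib) ?bnd_simp//.
      by ring.
    apply: sqr_Rintegral_le => //; apply: integrableS ib => //.
    by apply: subset_itvr; rewrite bnd_simp.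
rewrite ge0_integralZl//; last by rewrite lee_fin subr_ge0.
rewrite integral_prod_itv//.
apply: (@le_trans _ _ ((b - a)%:E * (M * (b - a))%:E)%E); last first.
  by rewrite -EFinM lee_fin le_eqVlt; apply/orP; left; apply/eqP; ring.
apply: lee_wpmul2l; first by rewrite lee_fin subr_ge0.
apply: le_integral_prod_itv => // s /andP[as_ sb]; apply: ltW.
have := hf (t := s); rewrite unlock; apply.
by rewrite (ltW (le_lt_trans a0 as_)) (le_trans sb).
Qed.

End drift.

Lemma normrM_le_sqr (R : realFieldType) (x y : R) :
  `|x * y| <= 2^-1 * (x ^+ 2 + y ^+ 2).
Proof.
have := sqr_ge0 (x - y); have := sqr_ge0 (x + y).
by rewrite ler_norml => ? ?; apply/andP; split; nra.
Qed.

Section product_expectation.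
Context d (Om : measurableType d) (R : realType) (P : probability Om R).
Implicit Types X Y N D : Om -> R.

Lemma integrable_sqr_EFin X : square_integrable P X ->
  P.-integrable setT (EFin \o (fun w => X w ^+ 2)).
Proof. exact: square_integrable_sqr. Qed.

Lemma Rintegral_polarization X Y :
  square_integrable P X -> square_integrable P Y ->
  \int[P]_w (X w * Y w) = 2^-1 * (\int[P]_w (X w ^+ 2) + \int[P]_w (Y w ^+ 2)
    - \int[P]_w ((X w - Y w) ^+ 2)).
Proof.
move=> sX sY.
have iX := integrable_sqr_EFin sX; have iY := integrable_sqr_EFin sY.
have iXY : P.-integrable setT (EFin \o (fun w => X w * Y w)).
  exact: square_integrable_mul.
have -> : \int[P]_w ((X w - Y w) ^+ 2) =
    \int[P]_w ((X w ^+ 2 + Y w ^+ 2) - 2 * (X w * Y w)).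
  by apply: eq_Rintegral => w _; ring.
rewrite RintegralB//; last 2 first.
- exact: (integrableD _ iX iY).
- exact: (integrableZl _ 2 iXY).
by rewrite RintegralD// RintegralZl//; field.
Qed.

(* [|X Y - N N'| <= |D N'| + |D' N| + |D D'|] for [X = N + D] and [Y = N' + D'];
   the weight [k] balances the drift [D] against the martingale part [N]. *)
Lemma Rintegral_mul_perturbation X Y N N' (k : R) : 0 < k ->
  square_integrable P X -> square_integrable P Y ->
  square_integrable P N -> square_integrable P N' ->
  `|\int[P]_w (X w * Y w) - \int[P]_w (N w * N' w)| <=
  2^-1 * (k + 1) * (\int[P]_w ((X w - N w) ^+ 2) + \int[P]_w ((Y w - N' w) ^+ 2))
  + 2^-1 * k^-1 * (\int[P]_w (N w ^+ 2) + \int[P]_w (N' w ^+ 2)).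
Proof.
move=> k0 sX sY sN sN'.
have iXY : P.-integrable setT (EFin \o (fun w => X w * Y w)).
  exact: square_integrable_mul.
have iNN : P.-integrable setT (EFin \o (fun w => N w * N' w)).
  exact: square_integrable_mul.
have iN := integrable_sqr_EFin sN; have iN' := integrable_sqr_EFin sN'.
have iD : P.-integrable setT (EFin \o (fun w => (X w - N w) ^+ 2)).
  exact: integrable_sqr_EFin (square_integrableB sX sN).
have iD' : P.-integrable setT (EFin \o (fun w => (Y w - N' w) ^+ 2)).
  exact: integrable_sqr_EFin (square_integrableB sY sN').
have iDD : P.-integrable setT
    (EFin \o (fun w => (X w - N w) ^+ 2 + (Y w - N' w) ^+ 2)).
  exact: (integrableD _ iD iD').
have iSN : P.-integrable setT (EFin \o (fun w => N w ^+ 2 + N' w ^+ 2)).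
  exact: (integrableD _ iN iN').
have iDD' : P.-integrable setT (EFin \o (fun w =>
    2^-1 * (k + 1) * ((X w - N w) ^+ 2 + (Y w - N' w) ^+ 2))).
  exact: (integrableZl _ (2^-1 * (k + 1)) iDD).
have iSN' : P.-integrable setT (EFin \o (fun w =>
    2^-1 * k^-1 * (N w ^+ 2 + N' w ^+ 2))).
  exact: (integrableZl _ (2^-1 * k^-1) iSN).
have iB : P.-integrable setT (EFin \o (fun w => X w * Y w - N w * N' w)).
  exact: (integrableB _ iXY iNN).
rewrite -RintegralB//.
apply: (le_trans (le_normr_Rintegral _ iB)) => //.
rewrite -(RintegralD measurableT iD iD') -(RintegralD measurableT iN iN').
rewrite -!RintegralZl// -RintegralD//.
apply: le_Rintegral => //.
- exact: integrable_norm iB.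
- exact: (integrableD _ iDD' iSN').
move=> w _.
set D := X w - N w; set D' := Y w - N' w.
have -> : X w = N w + D by rewrite /D subrKC.
have -> : Y w = N' w + D' by rewrite /D' subrKC.
have amgm (x y : R) : `|x * y| <= 2^-1 * (k * x ^+ 2) + 2^-1 * (k^-1 * y ^+ 2).
  have ki : 0 < k^-1 by rewrite invr_gt0.
  have kk : k * k^-1 = 1 by rewrite divff// gt_eqF.
  have h1 : 0 <= k^-1 * (k * x - y) ^+ 2 by rewrite mulr_ge0 ?sqr_ge0// ltW.
  have h2 : 0 <= k^-1 * (k * x + y) ^+ 2 by rewrite mulr_ge0 ?sqr_ge0// ltW.
  have e1 : k^-1 * (k * x - y) ^+ 2 =
    k * k^-1 * (k * x ^+ 2) - 2 * (k * k^-1) * (x * y) + k^-1 * y ^+ 2 by ring.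
  have e2 : k^-1 * (k * x + y) ^+ 2 =
    k * k^-1 * (k * x ^+ 2) + 2 * (k * k^-1) * (x * y) + k^-1 * y ^+ 2 by ring.
  rewrite e1 kk in h1; rewrite e2 kk in h2.
  by rewrite ler_norml; apply/andP; split; lra.
(* The weight is spent on the two mixed terms only; [D * D'] is split evenly and accounts for the
   [1] in [k + 1]. *)
have -> : (N w + D) * (N' w + D') - N w * N' w = D * N' w + (D' * N w + D * D').
  by ring.
apply: (le_trans (ler_normD _ _)); apply: (le_trans (lerD (lexx _) (ler_normD _ _))).
by have := amgm D (N' w); have := amgm D' (N w); have := normrM_le_sqr D D'; lra.
Qed.

End product_expectation.

(** * Second moments of Ito increments and the covariance estimate *)

Section expansion.
Context d (Om : measurableType d) (R : realType) (P : probability Om R).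
Variables (F : R -> set (set Om)) (W : R -> Om -> R) (T : R).
Variables (g I : R -> Om -> R).
Hypotheses (hF : complete_filtration P F) (hW : wiener_process P F W).
Hypothesis T0 : 0 <= T.
Hypothesis hI : ito_integral P F W T g I.

Lemma square_integrable_ito (u v : R) : 0 <= u <= T -> 0 <= v <= T ->
  square_integrable P (I u \- I v).
Proof.
wlog uv : u v / v <= u.
  move=> h uT vT; have [vu|uv] := leP v u; first exact: h.
  have := square_integrableN (h _ _ (ltW uv) vT uT).
  rewrite (_ : \- (I v \- I u) = I u \- I v)//.
  by apply/funext => w /=; rewrite opprB.
move=> uT vT; split.
  by apply: measurable_funB; exact: (measurable_ito hF hI).
have [u0 uT'] := andP uT; have [v0 _] := andP vT.
rewrite (ito_isometry hF hW T0 hI v0 uv uT').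
apply: (le_lt_trans _ (ito_integrand_L2 hI)).
have mT := progressively_measurable_prod hF T0 (ito_integrand_progressive hI).
rewrite (integral_prod_itv P mT); apply: ge0_le_integral => //.
- by move=> z _; rewrite lee_fin sqr_ge0.
- apply: measurable_sqrE.
  have mg := progressively_measurable_itv hF T0 (ito_integrand_progressive hI) v0 uT'.
  exact: mg.
- exact: (measurable_sqrE mT).
- move=> -[w s] _; rewrite lee_fin /= !exprMn; apply: ler_wpM2r; first exact: sqr_ge0.
  rewrite !indicE !mem_setE !in_itv/=.
  case: (boolP ((v < s) && _)) => [/andP[vs su]|_]; last by rewrite expr0n sqr_ge0.
  by rewrite (ltW (le_lt_trans v0 vs)) (le_trans su uT').
Qed.

Variable L : R -> R.
Hypothesis LE : forall s : R, 0 <= s <= T -> (\int[P]_w (g s w ^+ 2)%:E = (L s)%:E)%E.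

(** By the isometry and Tonelli, the second moment is the integral of [L] between [v] and [u], where
    [L] stays within [h] of [L l]. The two times are arbitrary and unordered, since the lemma serves
    for [(t + r, t)], [(t + s, t)] and [(t + r, t + s)]. *)
Lemma Rintegral_ito_increment (l h dl u v : R) :
  (forall s : R, 0 <= s <= T -> `|s - l| < dl -> `|L s - L l| <= h) ->
  0 <= u <= T -> 0 <= v <= T -> `|u - l| < dl -> `|v - l| < dl ->
  `|\int[P]_w ((I u w - I v w) ^+ 2) - L l * `|u - v| | <= h * `|u - v|.
Proof.
move=> hL; wlog uv : u v / v <= u.
  move=> H uT vT ul vl; have [vu|uv] := leP v u; first exact: H.
  rewrite [ `|u - v| ]distrC; have := H _ _ (ltW uv) vT uT vl ul.
  rewrite (_ : \int[P]_w ((I u w - I v w) ^+ 2) = \int[P]_w ((I v w - I u w) ^+ 2))//.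
  by apply: eq_Rintegral => w _; rewrite -sqrrN opprB.
move=> uT vT ul vl.
have [u0 uT'] := andP uT; have [v0 _] := andP vT.
have mg := progressively_measurable_itv hF T0 (ito_integrand_progressive hI) v0 uT'.
have near s : v < s <= u -> `|L s - L l| <= h /\ 0 <= s <= T.
  move=> /andP[vs su]; have sT : 0 <= s <= T.
    by rewrite (ltW (le_lt_trans v0 vs)) (le_trans su uT').
  split=> //; apply: hL => //.
  move: ul vl; rewrite !ltr_norml => /andP[? ?] /andP[? ?]; apply/andP; split; lra.
have isoE : (\int[P]_w ((I u w - I v w) ^+ 2))%:E =
    (\int[P \x lebesgue_measure]_z ((\1_(`]v, u]) z.2 * g z.2 z.1) ^+ 2)%:E)%E.
  rewrite /Rintegral fineK ?(ito_isometry hF hW T0 hI v0 uv uT')//.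
  rewrite -(ito_isometry hF hW T0 hI v0 uv uT').
  exact: integrable_fin_num (integrable_sqr_EFin (square_integrable_ito uT vT)).
rewrite [ `|u - v| ]ger0_norm ?subr_ge0// ler_distl -mulrBl -mulrDl -!lee_fin isoE.
apply/andP; split.
- apply: ge_integral_prod_itv => // s /near[h1 h2]; rewrite LE// lee_fin.
  by move: h1; rewrite ler_distl => /andP[].
- apply: le_integral_prod_itv => // s /near[h1 h2]; rewrite LE// lee_fin.
  by move: h1; rewrite ler_distl => /andP[].
Qed.

End expansion.

(** Puts [C1] in the shape produced by polarization: the three absolute values are the distances
    between [t], [t + r] and [t + s]. *)
Lemma C1E (R : realType) (r s : R) : C1 r s = 2^-1 * (`|r| + `|s| - `|r - s|).
Proof.
rewrite /C1; case: ifPn => [rs|]; last rewrite -ltNge => rs.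
  have [r0|r0] := leP 0 r; have [s0|s0] := leP 0 s.
  - rewrite (ger0_norm r0) (ger0_norm s0); have [rs'|rs'] := leP r s.
      by rewrite ler0_norm ?subr_le0//; lra.
    by rewrite gtr0_norm ?subr_gt0//; lra.
  - have -> : r = 0 by nra.
    by rewrite sub0r normrN normr0 add0r subrr mulr0 min_l.
  - have -> : s = 0 by nra.
    by rewrite subr0 normr0 addr0 subrr mulr0 min_r.
  - rewrite (ltr0_norm r0) (ltr0_norm s0); have [rs'|rs'] := leP (- r) (- s).
      by rewrite ger0_norm; lra.
    by rewrite ler0_norm; lra.
have [r0|r0] := leP 0 r; have [s0|s0] := leP 0 s; [nra| | |nra].
- by rewrite (ger0_norm r0) (ltr0_norm s0) ger0_norm; lra.
- by rewrite (ltr0_norm r0) (ger0_norm s0) ler0_norm; lra.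
Qed.

(** The arithmetic behind the expansion: with [rho] the square root on the right, each of three
    errors is at most [e / 3 * rho]. The choice of [k] gives [k^-1 * (L + 1) = e / 3] for the
    weighted martingale terms, where [h <= 1] ensures [N1, N2 <= (L + 1) * rho]; with [k] fixed, the
    bound on [r] and [s] makes the quadratic drift terms small; and [h <= e / 6] controls the
    variation of [L], since [|r| + |s| + |r - s| <= 4 * rho]. *)
Lemma expansion_bound (R : rcfType) (L M e h k r s XY NN DX DY N1 N2 N3 : R) :
  0 <= L -> 0 <= M -> 0 < e -> 0 < h -> h <= 1 -> h <= e / 6 ->
  k = 3 * (L + 1) / e ->
  `|r| < e / (6 * ((k + 1) * (M + 1))) -> `|s| < e / (6 * ((k + 1) * (M + 1))) ->
  `|XY - NN| <= 2^-1 * (k + 1) * (DX + DY) + 2^-1 * k^-1 * (N1 + N2) ->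
  NN = 2^-1 * (N1 + N2 - N3) ->
  `|N1 - L * `|r| | <= h * `|r| -> `|N2 - L * `|s| | <= h * `|s| ->
  `|N3 - L * `|r - s| | <= h * `|r - s| ->
  DX <= M * r ^+ 2 -> DY <= M * s ^+ 2 ->
  `|XY - L * (2^-1 * (`|r| + `|s| - `|r - s|))| <= e * Num.sqrt (r ^+ 2 + s ^+ 2).
Proof.
move=> L0 M0 e0 h0 h1 h6 kE rc sc pert pol q1 q2 q3 qX qY.
have k0 : 0 < k by rewrite kE divr_gt0// mulr_gt0//; lra.
move: rc sc; set c := (k + 1) * (M + 1) => rc sc.
have c0 : 0 < c by rewrite mulr_gt0//; lra.
have cE : (k + 1) * (M + 1) = c by [].
move: c c0 cE rc sc => c c0 cE rc sc.
set rho := Num.sqrt _.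
have rho2 : rho ^+ 2 = r ^+ 2 + s ^+ 2.
  by rewrite sqr_sqrtr// addr_ge0// sqr_ge0.
have rho0 : 0 <= rho by exact: sqrtr_ge0.
have r_rho : `|r| <= rho.
  by rewrite -sqrtr_sqr ler_wsqrtr// lerDl sqr_ge0.
have s_rho : `|s| <= rho.
  by rewrite -sqrtr_sqr ler_wsqrtr// lerDr sqr_ge0.
move: rho rho2 rho0 r_rho s_rho => rho rho2 rho0 r_rho s_rho.
have rs_rho : `|r - s| <= `|r| + `|s| := ler_normB _ _.
have rho_le : rho <= `|r| + `|s|.
  rewrite -(@ler_pXn2r _ 2)// ?nnegrE ?addr_ge0// rho2 sqrrD.
  rewrite !real_normK ?num_real//.
  by have := mulr_ge0 (normr_ge0 r) (normr_ge0 s); lra.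
have rho_c : rho * (3 * c) <= e.
  have : rho <= e / (6 * c) * 2 by lra.
  have -> : e / (6 * c) * 2 = e / (3 * c) by field; rewrite gt_eqF.
  by rewrite ler_pdivlMr// mulr_gt0.
have ki : k^-1 * (L + 1) = e / 3.
  by rewrite kE; field; rewrite !gt_eqF//; lra.
have ki0 : 0 < k^-1 by rewrite invr_gt0.
have N1le : N1 <= (L + 1) * rho.
  have : N1 <= (L + h) * `|r| by move: q1; rewrite ler_norml => /andP[_]; lra.
  by move=> /le_trans; apply; apply: ler_pM => //; lra.
have N2le : N2 <= (L + 1) * rho.
  have : N2 <= (L + h) * `|s| by move: q2; rewrite ler_norml => /andP[_]; lra.
  by move=> /le_trans; apply; apply: ler_pM => //; lra.
have p1 : 2^-1 * k^-1 * (N1 + N2) <= e / 3 * rho.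
  have : 2^-1 * k^-1 * (N1 + N2) <= 2^-1 * k^-1 * ((L + 1) * rho *+ 2).
    by apply: ler_wpM2l; [rewrite mulr_ge0// ltW|rewrite mulr2n lerD].
  move=> /le_trans; apply; rewrite -ki le_eqVlt; apply/orP; left; apply/eqP.
  by field; rewrite gt_eqF.
have p2 : 2^-1 * (k + 1) * (DX + DY) <= e / 3 * rho.
  have h2 : DX + DY <= (M + 1) * rho ^+ 2.
    by rewrite rho2; have := sqr_ge0 r; have := sqr_ge0 s; lra.
  have : 2^-1 * (k + 1) * (DX + DY) <= 2^-1 * (k + 1) * ((M + 1) * rho ^+ 2).
    by apply: ler_wpM2l => //; lra.
  move=> /le_trans; apply.
  have -> : 2^-1 * (k + 1) * ((M + 1) * rho ^+ 2) =
      2^-1 * (rho * ((k + 1) * (M + 1))) * rho by ring.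
  rewrite cE.
  by apply: ler_wpM2r => //; lra.
have p3 : `|NN - L * (2^-1 * (`|r| + `|s| - `|r - s|))| <= e / 3 * rho.
  have b : 2^-1 * (h * `|r| + h * `|s| + h * `|r - s|) <= e / 3 * rho.
    have : 2^-1 * (h * `|r| + h * `|s| + h * `|r - s|) <= h * (2 * rho).
      rewrite -!mulrDr mulrCA; apply: ler_wpM2l; first exact: ltW.
      by lra.
    by move=> /le_trans; apply; rewrite mulrA; apply: ler_wpM2r => //; lra.
  apply: le_trans b; rewrite pol.
  move: q1 q2 q3; rewrite !ler_norml => /andP[? ?] /andP[? ?] /andP[? ?].
  by apply/andP; split; lra.
apply: (le_trans (ler_distD NN _ _)).
by lra.
Qed.

Section covariance.
Context d (Om : measurableType d) (R : realType) (P : probability Om R).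
Variables (F : R -> set (set Om)) (W : R -> Om -> R) (T : R).
Variables (f g V : R -> Om -> R) (M : R).
Hypotheses (hF : complete_filtration P F) (hW : wiener_process P F W).
Hypothesis T0 : 0 < T.
Hypothesis hV : ito_process P F W T f g V.
Hypothesis hf : forall t : R, 0 <= t <= T -> ('E_P[fun w => (f t w ^+ 2)%R] < M%:E)%E.
Hypothesis hg : forall t : R, 0 <= t <= T -> 'E_P[fun w => (g t w ^+ 2)%R]%E \is a fin_num.

Let L (t : R) : R := fine 'E_P[fun w => (g t w ^+ 2)%R]%E.

Let LE s : 0 <= s <= T -> (\int[P]_w (g s w ^+ 2)%:E = (L s)%:E)%E.
Proof. by move=> sT; rewrite /L fineK ?hg// unlock. Qed.

Let M0 : 0 <= M.
Proof.
have T0' : (0 : R) <= 0 <= T by rewrite lexx ltW.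
have := hf T0'; rewrite unlock => /ltW; apply: contraTT; rewrite -!ltNge => M0.
by apply: lt_le_trans (integral_sqr_ge0 _ _); rewrite lte_fin.
Qed.

(** Increments of [V] inherit square integrability from the drift and from the stochastic integral,
    although [V] itself may have no second moment. The times are unordered, as [r] and [s] may be
    negative. *)
Let drift_estimate : exists I : R -> Om -> R, ito_integral P F W T g I /\
  forall u v : R, 0 <= u <= T -> 0 <= v <= T -> square_integrable P (V u \- V v) /\
  \int[P]_w (((V u w - V v w) - (I u w - I v w)) ^+ 2) <= M * (u - v) ^+ 2.
Proof.
have [I [hI hD]] := ito_process_drift_bound hF (ltW T0) hV hf.
exists I; split=> // u v.
wlog uv : u v / v <= u.
  move=> H uT vT; have [vu|uv] := leP v u; first exact: H.
  have [sV qV] := H _ _ (ltW uv) vT uT; split.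
    rewrite (_ : V u \- V v = \- (V v \- V u)); first exact: square_integrableN.
    by apply/funext => w /=; rewrite opprB.
  rewrite -sqrrN opprB; apply: le_trans qV; rewrite le_eqVlt; apply/orP; left.
  by apply/eqP; apply: eq_Rintegral => w _; ring.
move=> uT vT; have [u0 uT'] := andP uT; have [v0 _] := andP vT.
have sI := square_integrable_ito hF hW (ltW T0) hI uT vT.
have mD : measurable_fun setT (fun w => (V u w - V v w) - (I u w - I v w)).
  apply: measurable_funB; last by case: sI.
  by apply: measurable_funB; exact: (measurable_ito_process hF hV).
have sD : square_integrable P (fun w => (V u w - V v w) - (I u w - I v w)).
  by split=> //; apply: le_lt_trans (hD _ _ v0 uv uT') _; rewrite ltry.
split.
  rewrite (_ : V u \- V v =
    (fun w => (V u w - V v w) - (I u w - I v w)) \+ (I u \- I v)).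
    exact: square_integrableD.
  by apply/funext => w /=; rewrite subrK.
rewrite -lee_fin /Rintegral fineK; first exact: hD.
exact: integrable_fin_num (integrable_sqr_EFin sD).
Qed.

Let cov (t r s : R) : \bar R :=
  'E_P[fun w => ((V (t + r) w - V t w) * (V (t + s) w - V t w))%R]%E.

Lemma covariance_fin_num t r s : 0 < t < T ->
  0 <= t + r <= T -> 0 <= t + s <= T -> cov t r s \is a fin_num.
Proof.
move=> /andP[t0 tT] hr hs; rewrite /cov unlock.
have [I [_ hI]] := drift_estimate.
have tT' : 0 <= t <= T by rewrite !ltW.
have [s1 _] := hI _ _ hr tT'; have [s2 _] := hI _ _ hs tT'.
exact: integrable_fin_num (square_integrable_mul s1 s2).
Qed.

Lemma covariance_expansion t (e : R) : 0 < t < T ->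
  {within `[0, T], continuous L} -> 0 < e ->
  exists2 dl : R, 0 < dl & forall r s : R, `|r| < dl -> `|s| < dl ->
  `|fine (cov t r s) - L t * C1 r s| <= e * Num.sqrt (r ^+ 2 + s ^+ 2).
Proof.
move=> /andP[t0 tT] cL e0; have [I [hI hD]] := drift_estimate.
have M0' := M0.
have tT' : 0 <= t <= T by rewrite !ltW.
have L0 : 0 <= L t by rewrite -lee_fin -LE// integral_sqr_ge0.
pose h := Num.min 1 (e / 6).
have h0 : 0 < h by rewrite lt_min ltr01 divr_gt0.
have h1 : h <= 1 by rewrite ge_min lexx.
have h6 : h <= e / 6 by rewrite ge_min lexx orbT.
have [d1 d10 hd1] : exists2 d1 : R, 0 < d1 & forall s : R, 0 <= s <= T -> `|s - t| < d1 ->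
    `|L s - L t| <= h.
  have [+ _ _] := (continuous_within_itvP _ T0).1 cL.
  move=> /(_ t); rewrite in_itv/= t0 tT => /(_ isT)/cvgr_dist_le/(_ _ h0).
  move=> /nbhs_ballP[d1 /= d10 hd1]; exists d1 => // s _ st.
  by rewrite distrC; apply: hd1; rewrite /ball/= distrC.
pose k := 3 * (L t + 1) / e.
have k0 : 0 < k by rewrite divr_gt0// mulr_gt0//; lra.
have c0 : 0 < 6 * ((k + 1) * (M + 1)) by rewrite !mulr_gt0//; lra.
(* Here [d1] comes from the continuity of [L] at [t], the second bound tames the drift, and [t] and
   [T - t] keep [t + r] and [t + s] inside [[0, T]]. *)
pose dl := Num.min (Num.min d1 (e / (6 * ((k + 1) * (M + 1))))) (Num.min t (T - t)).
have dl0 : 0 < dl by rewrite !lt_min d10 t0 subr_gt0 tT divr_gt0.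
exists dl => // r s; rewrite !lt_min => /andP[/andP[rd1 rc] /andP[rt rT]].
move=> /andP[/andP[sd1 sc] /andP[st sT]].
have inT x : `|x| < t -> `|x| < T - t -> 0 <= t + x <= T.
  by rewrite !ltr_norml => /andP[? ?] /andP[? ?]; apply/andP; split; lra.
have rT' := inT _ rt rT; have sT' := inT _ st sT.
have [sX qX] := hD _ _ rT' tT'; have [sY qY] := hD _ _ sT' tT'.
have sN := square_integrable_ito hF hW (ltW T0) hI rT' tT'.
have sN' := square_integrable_ito hF hW (ltW T0) hI sT' tT'.
have tt : `|t - t| < d1 by rewrite subrr normr0.
have trt x : t + x - t = x by ring.
have iso := Rintegral_ito_increment hF hW (ltW T0) hI LE hd1.
have q1 := iso _ _ rT' tT' _ tt; rewrite trt in q1; move/(_ rd1) in q1.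
have q2 := iso _ _ sT' tT' _ tt; rewrite trt in q2; move/(_ sd1) in q2.
have q3 := iso _ _ rT' sT'; rewrite !trt in q3; move/(_ rd1 sd1) in q3.
have trs : t + r - (t + s) = r - s by ring.
rewrite trs in q3.
rewrite trt in qX; rewrite trt in qY.
have pert := Rintegral_mul_perturbation k0 sX sY sN sN'.
have pol := Rintegral_polarization sN sN'.
have e3 : \int[P]_w (((I (t + r) \- I t) w - (I (t + s) \- I t) w) ^+ 2) =
    \int[P]_w ((I (t + r) w - I (t + s) w) ^+ 2).
  by apply: eq_Rintegral => w _ /=; congr (_ ^+ 2); ring.
rewrite e3 /= in pol.
have covE : fine (cov t r s) =
    \int[P]_w ((V (t + r) \- V t) w * (V (t + s) \- V t) w).
  by rewrite /cov unlock.
rewrite covE C1E.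
exact: (expansion_bound L0 M0' e0 h0 h1 h6 erefl rc sc pert pol q1 q2 q3 qX qY).
Qed.

End covariance.

(** * Integral positive definiteness *)

Section ae.
Context d (T : measurableType d) (R : realType) (m : {measure set T -> \bar R}).

(* [filterS] is not usable when the carrier of [m] is only convertible to [T]. *)
Lemma ae_mono (S S' : T -> Prop) :
  {ae m, forall x, S x} -> (forall x, S x -> S' x) -> {ae m, forall x, S' x}.
Proof. by move=> + SS; apply: filterS. Qed.

Lemma ae_and (S S' : T -> Prop) :
  {ae m, forall x, S x} -> {ae m, forall x, S' x} -> {ae m, forall x, S x /\ S' x}.
Proof. by move=> + +; apply: filterS2. Qed.

End ae.

(** * Quadratic forms whose kernel is a mixture of products *)

Section mixture.
Context d (Y : measurableType d) (R : realType).
Variable M : {sigma_finite_measure set Y -> \bar R}.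
Variables (A : Y -> R) (B : Y -> R -> R) (C : Y -> R).
Hypothesis mA : measurable_fun setT A.
Hypothesis mB : measurable_fun [set: Y * measurableTypeR R] (fun z => B z.1 z.2).
Hypothesis B0 : forall p u, 0 <= B p u.
Local Open Scope ereal_scope.
Notation leb := (@lebesgue_measure R).
Hypothesis BC : forall p, \int[leb]_u (B p u)%:E = (C p)%:E.
Hypothesis iAC : M.-integrable setT (fun p => (A p * C p)%:E).

Let H (z : Y * measurableTypeR R) : \bar R := (A z.1 * B z.1 z.2)%:E.

Let mBp p : measurable_fun [set: measurableTypeR R] (fun u => (B p u)%:E).
Proof. by apply/measurable_EFinP; exact: (measurableT_comp mB (measurable_pair1 p)). Qed.

Let mH : measurable_fun setT H.
Proof.
apply/measurable_EFinP; apply: measurable_funM => //.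
exact: (measurableT_comp mA).
Qed.

(** Since [B] is nonnegative, integrating [|A * B|] over [u] gives [|A| * C]; so integrability of
    [A * C] suffices for Fubini although [A] has no sign. *)
Let iH : (M \x leb).-integrable setT H.
Proof.
apply: (integrable12ltyP M leb mH).2.
have -> : \int[M]_p \int[leb]_u `|H (p, u)| = \int[M]_p `|(A p * C p)%:E|.
  apply: eq_integral => p _.
  have C0 : (0 <= C p)%R.
    by rewrite -lee_fin -BC; apply: integral_ge0 => u _; rewrite lee_fin.
  transitivity (\int[leb]_u (`|A p|%:E * (B p u)%:E)).
    apply: eq_integral => u _; rewrite /H/= -EFinM; congr EFin.
    by rewrite normrM (ger0_norm (B0 _ _)).
  rewrite ge0_integralZl//; last by move=> u _; rewrite lee_fin.
  by rewrite BC /= normrM (ger0_norm C0) EFinM.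
by case/integrableP : iAC.
Qed.

Lemma integral_mixture :
  \int[M]_p (A p * C p)%:E = \int[leb]_u \int[M]_p (A p * B p u)%:E.
Proof.
rewrite -(Fubini iH); apply: eq_integral => p _.
have iB : leb.-integrable setT (fun u => (B p u)%:E).
  apply/integrableP; split=> //.
  under eq_integral do rewrite gee0_abs ?lee_fin//.
  by rewrite BC ltry.
by rewrite EFinM -BC -integralZl//; apply: eq_integral => u _; rewrite -EFinM.
Qed.

Lemma ae_integrable_mixture :
  {ae leb, forall u : R, M.-integrable setT (fun p => (A p * B p u)%:E)}.
Proof. exact: (ae_integrable2 iH). Qed.

Lemma measurable_mixture :
  measurable_fun [set: measurableTypeR R] (fun u => \int[M]_p (A p * B p u)%:E).
Proof. exact: (measurable_fubini_G iH). Qed.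

End mixture.

(** Tonelli identifies the integral of [|a x * a y|] with the square of that of [|a|], so finiteness
    of the former forces that of the latter. Integrability of each slice is thereby a conclusion
    rather than an assumption. *)
Lemma integrable_tensor d (X : measurableType d) (R : realType)
    (m : {sigma_finite_measure set X -> \bar R}) (a : X -> R) :
  measurable_fun setT a ->
  ((m \x m)%E).-integrable setT (fun p : X * X => (a p.1 * a p.2)%:E) ->
  m.-integrable setT (EFin \o a) /\
  (\int[m \x m]_p (a p.1 * a p.2)%:E = \int[m]_x (a x)%:E * \int[m]_x (a x)%:E)%E.
Proof.
move=> ma iaa.
have maa := measurable_int _ iaa.
have mna : measurable_fun setT (fun x => `|a x|%:E).
  by apply/measurable_EFinP; exact: measurableT_comp.
pose A := (\int[m]_x `|a x|%:E)%E.
have A0 : (0 <= A)%E by apply: integral_ge0 => x _; rewrite lee_fin.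
have AA : (A * A < +oo)%E.
  have := (integrable12ltyP m m maa).1 iaa.
  have -> : (\int[m]_x \int[m]_y `|(a x * a y)%:E| = \int[m]_x (`|a x|%:E * A))%E.
    apply: eq_integral => x _.
    under eq_integral do rewrite /= normrM EFinM.
    by rewrite ge0_integralZl.
  by rewrite ge0_integralZr.
have ia : m.-integrable setT (EFin \o a).
  apply/integrableP; split; first exact/measurable_EFinP.
  rewrite ltNge leye_eq; apply/negP => /eqP Ay.
  by move: AA; rewrite /A Ay mulyy ltxx.
split=> //; rewrite -integral12_prod_meas1// /fubini_F/=.
have fa : (\int[m]_x (a x)%:E)%E \is a fin_num by exact: integrable_fin_num ia.
under eq_integral do (under eq_integral do rewrite EFinM; rewrite integralZl//).
have E (r : R) : (\int[m]_x ((a x)%:E * r%:E) = \int[m]_x (a x)%:E * r%:E)%E.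
  exact: integralZr.
by have := E (fine (\int[m]_x (a x)%:E)%E); rewrite fineK.
Qed.

Section square_measure.
Context d (X : measurableType d) (R : realType).
Variable m : {sigma_finite_measure set X -> \bar R}.

(* The library attaches a sigma-finite structure to [m \x m] only when [m] is a
   subprobability. *)
Definition square_measure : set (X * X) -> \bar R := (m \x m)%E.

HB.instance Definition _ := isMeasure.Build _ _ _ square_measure
  (measure0 (m \x m)%E) (measure_ge0 (m \x m)%E)
  (@measure_semi_sigma_additive _ _ _ (m \x m)%E).

Let square_measure_sigma_finite : sigma_finite setT square_measure.
Proof.
have [F [TF ndF Foo]] := (sigma_finiteP setT m).1 (sigma_finiteT m).
exists (fun n => F n `*` F n).
  rewrite -setXTT TF predeqE => -[x y]; split.
    move=> [/= [n _ Fnx] [k _ Gky]]; exists (maxn n k) => //; split.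
    - by move: x Fnx; exact/subsetPset/ndF/leq_maxl.
    - by move: y Gky; exact/subsetPset/ndF/leq_maxr.
  by move=> [n _ []/= ? ?]; split; exists n.
move=> k; have [? ?] := Foo k; split; first exact: measurableX.
by rewrite /square_measure product_measure1E// lte_mul_pinfty// ge0_fin_numE.
Qed.

HB.instance Definition _ := Measure_isSigmaFinite.Build _ _ _ square_measure
  square_measure_sigma_finite.

End square_measure.

Section quadratic_form.
Context d (X : measurableType d) (R : realType).
Variable m : {sigma_finite_measure set X -> \bar R}.
Variables (k : X -> R -> R) (C : X -> X -> R) (K : X -> R).
Hypothesis mk : measurable_fun [set: X * measurableTypeR R] (fun z => k z.1 z.2).
Hypothesis k0 : forall x u, 0 <= k x u.
Local Open Scope ereal_scope.
Notation leb := (@lebesgue_measure R).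
Hypothesis kC : forall x y, \int[leb]_u (k x u * k y u)%:E = (C x y)%:E.
Hypothesis mK : measurable_fun setT K.
Let A (p : X * X) : R := (K p.1 * K p.2)%R.
Let B (p : X * X) (u : R) : R := (k p.1 u * k p.2 u)%R.
Let CC (p : X * X) : R := C p.1 p.2.
Hypothesis iQ : (m \x m).-integrable setT (fun p : X * X => (A p * CC p)%:E).

Let mA : measurable_fun setT A.
Proof. by apply: measurable_funM; exact: (measurableT_comp mK). Qed.

Let mB : measurable_fun [set: (X * X) * measurableTypeR R] (fun z => B z.1 z.2).
Proof.
have m1 : measurable_fun [set: (X * X) * measurableTypeR R] (fun z => z.1.1).
  exact: measurableT_comp.
have m2 : measurable_fun [set: (X * X) * measurableTypeR R] (fun z => z.1.2).
  exact: measurableT_comp.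
apply: measurable_funM.
- exact: (measurableT_comp mk (measurable_fun_pair m1 (@measurable_snd _ _ _ _))).
- exact: (measurableT_comp mk (measurable_fun_pair m2 (@measurable_snd _ _ _ _))).
Qed.

Let B0 p u : (0 <= B p u)%R. Proof. by rewrite mulr_ge0. Qed.

Let G (u : R) : \bar R := \int[m \x m]_p (A p * B p u)%:E.

Let integral_Q : \int[m \x m]_p (A p * CC p)%:E = \int[leb]_u G u.
Proof.
exact: (@integral_mixture _ _ R (square_measure m) A B CC mA mB B0 (fun p => kC p.1 p.2) iQ).
Qed.

Let mG : measurable_fun [set: measurableTypeR R] G.
Proof.
exact: (@measurable_mixture _ _ R (square_measure m) A B CC mA mB B0 (fun p => kC p.1 p.2) iQ).
Qed.

Let ae_square : {ae leb, forall u : R,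
  m.-integrable setT (fun x => (K x * k x u)%:E) /\
  G u = \int[m]_x (K x * k x u)%:E * \int[m]_x (K x * k x u)%:E}.
Proof.
apply: (ae_mono (@ae_integrable_mixture _ _ R (square_measure m) A B CC mA mB B0
  (fun p => kC p.1 p.2) iQ)) => u iu.
have AB p : (A p * B p u = (K p.1 * k p.1 u) * (K p.2 * k p.2 u))%R by rewrite mulrACA.
rewrite /G; under eq_integral do rewrite AB.
apply: (@integrable_tensor _ _ _ m (fun x => K x * k x u)%R).
  by apply: measurable_funM => //; exact: (measurableT_comp mk (measurable_pair2 u)).
by under eq_fun do rewrite -AB.
Qed.

(** [G u] is known to be a square only for almost every [u]; passing to [|G|] gives a function that
    is nonnegative everywhere and has the same integral. *)
Let integral_G : \int[leb]_u G u = \int[leb]_u `|G u|.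
Proof.
apply: (@ae_eq_integral _ (measurableTypeR R) R leb setT _ G) => //.
  exact: measurableT_comp mG.
apply: (ae_mono ae_square) => u [iu ->] _.
rewrite gee0_abs//; have := integrable_fin_num measurableT iu.
by move=> /fineK <-; rewrite -EFinM lee_fin -expr2 sqr_ge0.
Qed.

Lemma quadratic_form_ge0 : 0 <= \int[m \x m]_p (A p * CC p)%:E.
Proof. by rewrite integral_Q integral_G; exact: integral_ge0. Qed.

Lemma quadratic_form_eq0 : \int[m \x m]_p (A p * CC p)%:E <= 0 ->
  {ae leb, forall u : R, m.-integrable setT (fun x => (K x * k x u)%:E) /\
  \int[m]_x (K x * k x u)%:E = 0}.
Proof.
move=> Q0; have : \int[leb]_u `|G u| = 0.
  by apply/eqP; rewrite eq_le -{1}integral_G -integral_Q Q0 integral_ge0.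
move=> /(ae_eq_integral_abs leb measurableT mG) G0.
apply: (ae_mono (ae_and G0 ae_square)) => u [/(_ I) {}G0 [iu GE]]; split=> //.
move: GE; rewrite G0; have := integrable_fin_num measurableT iu.
move=> /fineK <-; rewrite -EFinM => -[/esym/eqP].
by rewrite mulf_eq0 orbb => /eqP ->.
Qed.

End quadratic_form.

Section dense.
Context (R : realType).

Lemma ae_lebesgue_itv (S : R -> Prop) (a b : R) : a < b ->
  {ae (@lebesgue_measure R), forall u, S u} -> exists2 u, a < u < b & S u.
Proof.
move=> ab aeS; apply: contrapT => noS.
have : lebesgue_measure.-negligible `]a, b[%classic.
  apply: negligibleS aeS => u /=; rewrite in_itv/= => uab Su.
  by apply: noS; exists u.
move=> /negligibleP => /(_ (measurable_itv _)) h.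
have e : lebesgue_measure `]a, b[%classic = (b - a)%:E.
  by rewrite lebesgue_measure_itv/= lte_fin ab.
have : (b - a)%:E = 0%:E :> \bar R := etrans (esym e) h.
by move=> -[/eqP]; rewrite subr_eq0 gt_eqF.
Qed.

End dense.

(** * The layer representation of [C1] *)

Section kernel.
Context (R : realType).
Notation mu := (@completed_lebesgue_measure R).
Notation leb := (@lebesgue_measure R).
Notation Tc := (caratheodory_type (@wlength R idfun)^*%mu).

(** The level 0 is excluded on both sides, so that layers of points of opposite signs have disjoint
    supports. *)
Definition layer (x u : R) : R := if (0 < u <= x) || (x <= u < 0) then 1 else 0.

Lemma layer_ge0 x u : 0 <= layer x u.
Proof. by rewrite /layer; case: ifP. Qed.

Lemma ge0_layerE x u : 0 <= x -> layer x u = if 0 < u <= x then 1 else 0.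
Proof.
move=> x0; rewrite /layer; case: (boolP (x <= u < 0)) => [/andP[h1 h2]|_].
  by have := le_lt_trans (le_trans x0 h1) h2; rewrite ltxx.
by rewrite orbF.
Qed.

Lemma le0_layerE x u : x <= 0 -> layer x u = if x <= u < 0 then 1 else 0.
Proof.
move=> x0; rewrite /layer; case: (boolP (0 < u <= x)) => [/andP[h1 h2]|_] //.
by have := lt_le_trans h1 (le_trans h2 x0); rewrite ltxx.
Qed.

Lemma layerM_opp x y u : x <= 0 -> 0 <= y -> layer x u * layer y u = 0.
Proof.
move=> x0 y0; rewrite le0_layerE// ge0_layerE//.
case: ifP => [/andP[_ u0]|_]; last by rewrite mul0r.
by rewrite ltNge (ltW u0) /= mulr0.
Qed.

(** For points on the same side of 0, the product is the indicator of the interval between 0 and the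
    nearer point. *)
Lemma integral_layer x y : (\int[leb]_u (layer x u * layer y u)%:E = (C1 x y)%:E)%E.
Proof.
have [x0|/ltW x0] := leP 0 x; have [y0|/ltW y0] := leP 0 y.
- transitivity (\int[leb]_u (\1_(`]0%R, (Num.min x y)]) u)%:E)%E.
    apply: eq_integral => u _; congr EFin.
    rewrite !ge0_layerE// indicE mem_setE in_itv/= le_min.
    by case: (0 < u); case: (u <= x); case: (u <= y); rewrite ?mulr1 ?mulr0.
  rewrite integral_indic//= setIT lebesgue_measure_itv/= lte_fin.
  rewrite /C1 mulr_ge0// !ger0_norm// sube0.
  by case: ltP => // h; congr EFin; apply/eqP; rewrite eq_le h le_min x0 y0.
- rewrite integral0_eq; last by move=> u _; rewrite mulrC layerM_opp.
  (* The test [0 <= x * y] also succeeds when one of the points is 0; the minimum is then 0 as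
     well. *)
  rewrite /C1; case: ifPn => // xy.
  have /eqP : x * y = 0 by apply/eqP; rewrite eq_le xy mulr_ge0_le0.
  rewrite mulf_eq0 => /orP[] /eqP ->; first by rewrite normr0 min_l.
  by rewrite normr0 min_r.
- rewrite integral0_eq; last by move=> u _; rewrite layerM_opp.
  rewrite /C1; case: ifPn => // xy.
  have /eqP : x * y = 0 by apply/eqP; rewrite eq_le xy mulr_le0_ge0.
  rewrite mulf_eq0 => /orP[] /eqP ->; first by rewrite normr0 min_l.
  by rewrite normr0 min_r.
- transitivity (\int[leb]_u (\1_(`[(Num.max x y), 0%R[) u)%:E)%E.
    apply: eq_integral => u _; congr EFin.
    rewrite !le0_layerE// indicE mem_setE in_itv/= ge_max.
    by case: (x <= u); case: (y <= u); case: (u < 0); rewrite ?mulr1 ?mulr0.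
  rewrite integral_indic//= setIT lebesgue_measure_itv/= lte_fin.
  rewrite /C1 mulr_le0// !ler0_norm// add0e oppr_max.
  case: ltP => // h; congr EFin; apply/eqP; rewrite eq_le le_min !oppr_ge0 x0 y0/=.
  by move: h; rewrite le_max ge_min !oppr_le0.
Qed.

(** Carries Borel functions such as [layer] and [C1] over to the Lebesgue sigma-algebra, on which
    [K] lives. *)
Lemma measurable_id_completed :
  measurable_fun [set: Tc] (fun x : Tc => x : measurableTypeR R).
Proof. by move=> _ A mA; rewrite setTI; exact: sub_caratheodory. Qed.

Lemma measurable_layer :
  measurable_fun [set: Tc * measurableTypeR R] (fun z => layer z.1 z.2).
Proof.
have m1 : measurable_fun [set: Tc * measurableTypeR R] (fun z => z.1 : R).
  exact: (measurableT_comp measurable_id_completed (@measurable_fst _ _ _ _)).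
have m2 : measurable_fun [set: Tc * measurableTypeR R] (fun z => z.2 : R).
  exact: measurable_snd.
have m0 : measurable_fun [set: Tc * measurableTypeR R] (cst (0 : R)).
  exact: measurable_cst.
apply: measurable_fun_ifT => //; apply: measurable_or; apply: measurable_and.
- exact: measurable_fun_ltr.
- exact: measurable_fun_ler.
- exact: measurable_fun_ler.
- exact: measurable_fun_ltr.
Qed.

End kernel.

(** Dynkin's argument: the measurable sets over which [k] integrates to 0 form a lambda-system, by
    countable additivity of the integral of an integrable function. *)
Lemma integral_eq0_generated d (T : measurableType d) (R : realType)
    (m : {measure set T -> \bar R}) (G : set (set T)) (k : T -> \bar R) :
  setI_closed G -> G `<=` measurable -> m.-integrable setT k ->
  (\int[m]_x k x = 0)%E -> (forall A, G A -> (\int[m]_(x in A) k x = 0)%E) ->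
  forall A, <<s G>> A -> (\int[m]_(x in A) k x = 0)%E.
Proof.
move=> GI Gm ik kT kG.
pose H := [set A : set T | measurable A /\ (\int[m]_(x in A) k x = 0)%E].
have mk := measurable_int _ ik.
suff GH : <<s G>> `<=` H by move=> A /GH[].
apply: (lambda_system_subset GI _ _ (fun X _ => @subsetT _ X)); last first.
  by move=> A GA; split; [exact: Gm | exact: kG].
apply/dynkin_lambda_system; split.
- by split.
- move=> A [mA kA]; have mAC := measurableC mA; split=> //.
  have := kT; rewrite -(setUv A) integral_setU//=.
  + by rewrite kA add0e.
  + by rewrite setUv.
  + by apply/disj_setPS; rewrite setICr.
- move=> F tF HF; split; first by apply: bigcup_measurable => n _; have [] := HF n.
  rewrite integral_bigcup//; last 2 first.
  + by move=> n; have [] := HF n.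
  + apply: integrableS ik => //.
    by apply: bigcup_measurable => n _; have [] := HF n.
  by rewrite eseries0// => n _ _; have [] := HF n.
Qed.

(** * Functions with zero integral against almost every layer *)

Section vanishing.
Context (R : realType).
Notation mu := (@completed_lebesgue_measure R).
Notation leb := (@lebesgue_measure R).
Notation Tc := (caratheodory_type (@wlength R idfun)^*%mu).

(** Half-open intervals generate the Borel sets only. A Lebesgue measurable set is a Borel set
    together with a disjoint null set, which contributes nothing to the integral. *)
Lemma completed_integral_ae_eq0 (k : Tc -> \bar R) :
  mu.-integrable setT k -> (\int[mu]_x k x = 0)%E ->
  (forall a b : R, (\int[mu]_(x in `]a, b]) k x = 0)%E) ->
  ae_eq mu setT k (cst 0%E).
Proof.
move=> ik kT kab; apply: integral_ae_eq => // E _ mE.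
rewrite integral0.
have mk := measurable_int _ ik.
have : completed_algebra_gen leb E.
  by rewrite -g_sigma_completed_algebra_genE completed_caratheodory_measurable.
move=> [A mA [N nN AN]].
have cA : measurable (A : set Tc) by exact: sub_caratheodory.
have nN' : mu.-negligible N.
  by case: nN => B [mB B0 NB]; exists B; split=> //; exact: sub_caratheodory.
have cN : measurable (N : set Tc) by exact: completed_lebesgue_measure_is_complete.
have N0 : mu N = 0%E by apply/negligibleP.
have cND : measurable (N `\` A : set Tc) by exact: measurableD.
have -> : E = A `|` (N `\` A).
  rewrite -AN; apply/seteqP; split=> x /=; last by tauto.
  by have [Ax|nAx] := pselect (A x); tauto.
rewrite integral_setU//; last 2 first.
- exact: measurable_funTS.
- by apply/disj_setPS => x /= [Ax [_ /(_ Ax)]].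
rewrite [X in (_ + X)%E](null_set_integral _ _ _)//; last 2 first.
- exact: measurable_funTS.
- by apply/eqP; rewrite -measure_le0 -N0; apply: le_measure; rewrite ?inE//; exact: subDsetl.
rewrite adde0; apply: (@integral_eq0_generated _ Tc R mu (@ocitv R) k) => //.
- exact: ocitvI.
- by move=> _ [[a b] _ <-]; apply: sub_caratheodory; apply: sub_sigma_algebra; exact: is_ocitv.
- by move=> _ [[a b] _ <-]; exact: kab.
Qed.

(** A level closer to 0 is below more points; such a level supplies the dominating function in
    [ray_integral]. *)
Lemma layer_le (x u v : R) : (0 < u <= v) \/ (v <= u < 0) -> layer x v <= layer x u.
Proof.
rewrite /layer => -[/andP[u0 uv]|/andP[vu u0]].
- case: ifPn => [|_]; last by case: ifP.
  move=> /orP[/andP[v0 vx]|/andP[_ v0]]; last first.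
    by have := lt_trans (lt_le_trans u0 uv) v0; rewrite ltxx.
  by rewrite u0 (le_trans uv vx).
- case: ifPn => [|_]; last by case: ifP.
  move=> /orP[/andP[v0 vx]|/andP[xv v0]].
    by have := lt_trans v0 (le_lt_trans vu u0); rewrite ltxx.
  by rewrite u0 (le_trans xv vu) orbT.
Qed.

(* The limit of the support of [layer ^~ u] as [u] decreases to [c]. *)
Definition ray (c : R) : set R :=
  if 0 < c then `]c, +oo[%classic else `]-oo, c]%classic.

Lemma indic_ray c x : \1_(ray c) x = (if 0 < c then c < x else x <= c)%:R :> R.
Proof.
by rewrite indicE /ray; case: ifP => _; rewrite mem_setE in_itv/= ?andbT.
Qed.

Lemma measurable_ray c : measurable (ray c : set Tc).
Proof. by apply: sub_caratheodory; rewrite /ray; case: ifP. Qed.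

Lemma ray_itv (p q x : R) : 0 < p \/ q < 0 -> p <= q ->
  \1_(`]p, q]) x = (if 0 < p then \1_(ray p) x - \1_(ray q) x
                   else \1_(ray q) x - \1_(ray p) x) :> R.
Proof.
move=> pq0 pq; rewrite !indic_ray indicE mem_setE in_itv/=; case: ifPn => p0.
  rewrite p0 (lt_le_trans p0 pq).
  case: (ltP p x) => px; case: (leP x q) => qx /=; rewrite ?subr0 ?subrr//.
  by have := lt_le_trans qx (le_trans px pq); rewrite ltxx.
have q0 : q < 0 by case: pq0 => // p0'; move: p0; rewrite p0'.
rewrite (negbTE p0) (lt_gtF q0).
case: (ltP p x) => px; case: (leP x q) => qx /=; rewrite ?subr0 ?subrr//.
by have := lt_le_trans qx (le_trans px pq); rewrite ltxx.
Qed.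

Lemma measurable_layer_l (w : R) : measurable_fun [set: Tc] (fun x : Tc => layer x w).
Proof.
exact: (measurableT_comp (@measurable_layer R)
  (measurable_pair2 (w : measurableTypeR R))).
Qed.

Variable K : R -> R.
Hypothesis mK : measurable_fun [set: Tc] K.
Hypothesis layer0 : {ae leb, forall u : R,
  mu.-integrable setT (fun x : Tc => (K x * layer x u)%:E) /\
  (\int[mu]_x (K x * layer x u)%:E = 0)%E}.

(** The bound [n.+1%:R^-1] makes [u n] tend to [c], while [|c| / 2] keeps it on the same side of 0
    when [c] is negative. Strict approach from the right decides the membership of the point [c] in
    the limiting ray. *)
Let cvg_layer (c : R) (u : nat -> R) (x : R) : c != 0 ->
  (forall n, c < u n < c + Num.min (`|c| / 2) n.+1%:R^-1) ->
  \forall n \near \oo, layer x (u n) = \1_(ray c) x.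
Proof.
move=> c0 hu; rewrite indicE /ray; case: ifPn => [cp|cn].
- rewrite mem_setE in_itv/= andbT; case: (ltP c x) => cx; last first.
    apply: nearW => n; have /andP[un _] := hu n.
    rewrite /layer (lt_gtF (lt_trans cp un)) andbF orbF leNgt.
    by rewrite (le_lt_trans cx un) andbF.
  have xc : 0 < x - c by rewrite subr_gt0.
  near=> n; have /andP[un un'] := hu n.
  rewrite /layer (lt_trans cp un) /=.
  suff -> : u n <= x by [].
  apply: ltW; apply: (lt_le_trans un').
  rewrite -lerBrDl ge_min; apply/orP; right; apply: ltW.
  by near: n; exact: (near_infty_natSinv_lt (PosNum xc)).
- have {}cn : c < 0 by rewrite lt_neqAle c0 leNgt.
  have un0 n : u n < 0.
    have /andP[_ /lt_le_trans] := hu n; apply.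
    rewrite -lerBrDl sub0r ge_min ltr0_norm// ler_pdivrMr//.
    by apply/orP; left; rewrite ler_peMr// ?ler1n// oppr_ge0 ltW.
  rewrite mem_setE in_itv/=; case: (leP x c) => cx.
    apply: nearW => n; have /andP[un _] := hu n.
    by rewrite /layer un0 (le_trans cx (ltW un)) orbT.
  have xc : 0 < x - c by rewrite subr_gt0.
  near=> n; have /andP[un un'] := hu n.
  rewrite /layer (lt_gtF (un0 n)) /= un0 andbT.
  suff : u n < x by move=> h; rewrite leNgt h.
  apply: (lt_le_trans un').
  rewrite -lerBrDl ge_min; apply/orP; right; apply: ltW.
  by near: n; exact: (near_infty_natSinv_lt (PosNum xc)).
Unshelve. all: by end_near. Qed.

Let good u := mu.-integrable setT (fun x : Tc => (K x * layer x u)%:E) /\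
  (\int[mu]_x (K x * layer x u)%:E = 0)%E.

(** The hypothesis may fail at [c] itself, but good levels are dense. Dominated convergence along
    good levels decreasing to [c] gives the result at every nonzero [c]. *)
Lemma ray_integral (c : R) : c != 0 ->
  mu.-integrable setT (fun x : Tc => (K x * \1_(ray c) x)%:E) /\
  (\int[mu]_x (K x * \1_(ray c) x)%:E = 0)%E.
Proof.
move=> c0.
have nc : 0 < `|c| by rewrite normr_gt0.
have [u hu] : exists u : nat -> R, forall n,
    (c < u n < c + Num.min (`|c| / 2) n.+1%:R^-1) /\ good (u n).
  suff /choice[u hu] : forall n : nat, exists u,
    (c < u < c + Num.min (`|c| / 2) n.+1%:R^-1) /\ good u by exists u.
  move=> n; have /(ae_lebesgue_itv)/(_ layer0)[u uc gu] : c < c + Num.min (`|c| / 2) n.+1%:R^-1.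
    by rewrite ltrDl lt_min divr_gt0//= invr_gt0 ltr0n.
  by exists u.
(* A good level between 0 and all the [u n], to dominate by [|K| * layer v]. For negative [c] it is
   taken in []c / 2, 0[], as [u n < c + |c| / 2 = c / 2]. *)
have [v [hv gv]] : exists v, (forall n, (0 < v <= u n) \/ (u n <= v < 0)) /\ good v.
  have [cp|cn] := ltP 0 c.
    have /(ae_lebesgue_itv)/(_ layer0)[v /andP[v0 vc] gv] : 0 < c by [].
    exists v; split=> // n; left; rewrite v0 ltW//.
    by apply: lt_trans vc _; have [/andP[]] := hu n.
  have {}cn : c < 0 by rewrite lt_neqAle c0.
  have /(ae_lebesgue_itv)/(_ layer0)[v /andP[v0 vc] gv] : c / 2 < 0 by lra.
  exists v; split=> // n; right; rewrite vc andbT ltW//.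
  have [/andP[_ /lt_le_trans h] _] := hu n; apply: h; apply: ltW.
  apply: le_lt_trans v0; rewrite -lerBrDl ge_min; apply/orP; left.
  by rewrite ltr0_norm//; lra.
have mf (w : R) : measurable_fun [set: Tc] (fun x : Tc => (K x * layer x w)%:E).
  by apply/measurable_EFinP; exact: (measurable_funM mK (measurable_layer_l w)).
have mr : measurable_fun [set: Tc] (fun x : Tc => (K x * \1_(ray c) x)%:E).
  have mi : measurable_fun [set: Tc] (\1_(ray c) : Tc -> R).
    exact: (measurable_indic (measurable_ray c)).
  by apply/measurable_EFinP; exact: (measurable_funM mK mi).
have [//|//|||| ir _ h] := @dominated_convergence _ Tc R mu setT measurableT
  (fun n (x : Tc) => (K x * layer x (u n))%:E) (fun x : Tc => (K x * \1_(ray c) x)%:E)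
  (fun x : Tc => `|(K x * layer x v)%:E|%E).
- apply: aeW => x _; apply: cvg_near_cst.
  have hu' n : c < u n < c + Num.min (`|c| / 2) n.+1%:R^-1 by have [] := hu n.
  by have := cvg_layer x c0 hu'; apply: filterS => n ->.
- by apply: integrable_abse; case: gv.
- apply: aeW => x n _; rewrite lee_fin !normrM ler_wpM2l//.
  by rewrite !ger0_norm ?layer_ge0//; exact: layer_le.
split=> //; have /cvg_lim <- // := h.
under eq_fun do rewrite (hu _).2.2.
exact: lim_cst.
Qed.

Lemma itv_integral (p q : R) : 0 < p \/ q < 0 -> p <= q ->
  mu.-integrable setT (fun x : Tc => (K x * \1_(`]p, q]) x)%:E) /\
  (\int[mu]_x (K x * \1_(`]p, q]) x)%:E = 0)%E.
Proof.
move=> pq0 pq.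
have p0 : p != 0.
  case: pq0 => [/lt0r_neq0//|q0]; rewrite lt_eqF//; exact: le_lt_trans q0.
have q0 : q != 0.
  case: pq0 => [p0'|q0']; last by rewrite lt_eqF.
  by rewrite gt_eqF//; exact: lt_le_trans pq.
have [ip Ip] := ray_integral p0; have [iq Iq] := ray_integral q0.
have E x : (K x * \1_(`]p, q]) x)%:E =
    (if (0 < p)%R then (K x * \1_(ray p) x)%:E - (K x * \1_(ray q) x)%:E
     else (K x * \1_(ray q) x)%:E - (K x * \1_(ray p) x)%:E)%E.
  by rewrite ray_itv//; case: ifP => _; rewrite -EFinB mulrBr.
have [p0'|p0'] := boolP (0 < p); [rewrite p0' in E|rewrite (negbTE p0') in E].
  split; first by under eq_fun do rewrite E; exact: integrableB.
  by under eq_integral do rewrite E; rewrite integralB// Ip Iq subee.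
split; first by under eq_fun do rewrite E; exact: integrableB.
by under eq_integral do rewrite E; rewrite integralB// Ip Iq subee.
Qed.

Let itv_ae0 (p q : R) : 0 < p \/ q < 0 -> p <= q ->
  {ae mu, forall x : Tc, p < x <= q -> K x = 0}.
Proof.
move=> pq0 pq; have [ik k0] := itv_integral pq0 pq.
have := @completed_integral_ae_eq0 _ ik k0.
have H : forall a b : R,
    (\int[mu]_(x in `]a, b]) (K x * \1_(`]p, q]) x)%:E = 0)%E.
  move=> a b; rewrite integral_mkcond.
  have E (x : R) : (((fun x => (K x * \1_(`]p, q]) x)%:E) \_ `]a, b]) x
      = (K x * \1_(`](Num.max a p), (Num.min b q)]) x)%:E)%E.
    rewrite patchE !indicE !mem_setE !in_itv/= gt_max le_min.
    by case: (a < x); case: (p < x); case: (x <= b); case: (x <= q); rewrite ?mulr1 ?mulr0.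
  under eq_integral do rewrite E.
  have [ab|ab] := leP (Num.max a p) (Num.min b q).
    apply: (itv_integral _ ab).2; case: pq0 => [p0|q0].
      by left; rewrite lt_max p0 orbT.
    by right; rewrite gt_min q0 orbT.
  apply: integral0_eq => x _; rewrite indicE mem_setE in_itv/=.
  case: (boolP (_ < x <= _)) => [/andP[h1 h2]|_]; last by rewrite mulr0.
  by have := lt_le_trans (lt_trans ab h1) h2; rewrite ltxx.
move=> /(_ H) h; apply: (ae_mono h) => x /(_ I) -[].
move=> + xpq; have -> : \1_(`]p, q]) x = 1 :> R.
  by rewrite indicE mem_set//= in_itv/=; exact: xpq.
by rewrite mulr1.
Qed.

(** Integrability of [K] is available only away from 0, so the nonzero reals are exhausted by the
    countably many intervals []1 / (n + 1), n + 1]] and their negative counterparts; the point 0 is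
    a null set. *)
Lemma layer_determining : (\int[mu]_x `|(K x)%:E| = 0)%E.
Proof.
have pos (n : nat) : {ae mu, forall x : Tc, n.+1%:R^-1 < x <= n.+1%:R -> K x = 0}.
  apply: itv_ae0; first by left; rewrite invr_gt0 ltr0n.
  by rewrite (le_trans (y := 1))// ?ler1n// invf_le1 ?ltr0n// ler1n.
have neg (n : nat) : {ae mu, forall x : Tc, - n.+1%:R < x <= - n.+1%:R^-1 -> K x = 0}.
  apply: itv_ae0; first by right; rewrite oppr_lt0 invr_gt0 ltr0n.
  by rewrite lerN2 (le_trans (y := 1))// ?ler1n// invf_le1 ?ltr0n// ler1n.
have z0 : {ae mu, forall x : Tc, x != 0 :> R}.
  exists [set (0 : R)]; split.
  - by apply: sub_caratheodory; exact: measurable_set1.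
  - have -> : mu [set 0] = leb [set 0] by [].
    exact: lebesgue_measure_set1.
  - by move=> x /= /negP; rewrite negbK => /eqP.
have K0 : ae_eq mu setT (fun x : Tc => (K x)%:E) (cst 0%E).
  apply: (ae_mono (ae_and z0 (ae_and (ae_foralln pos) (ae_foralln neg)))).
  move=> x [x0 [hp hn]] _; congr EFin.
  have [xp|xn] := ltP 0 x.
    have [n1 _ /(_ _ (leqnn _)) h1] := near_infty_natSinv_lt (PosNum xp).
    have [n2 h2] : exists n2 : nat, x < n2%:R.
      by exists (Num.bound x); exact: archi_boundP (ltW xp).
    apply: (hp (maxn n1 n2)); apply/andP; split.
      apply: le_lt_trans h1; rewrite lef_pV2 ?posrE ?ltr0n// ler_nat ltnS.
      exact: leq_maxl.
    apply: ltW; apply: (lt_le_trans h2); rewrite ler_nat.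
    exact: (leq_trans (leq_maxr n1 n2)).
  have {}xn : 0 < - x by rewrite oppr_gt0 lt_neqAle x0.
  have [n1 _ /(_ _ (leqnn _)) h1] := near_infty_natSinv_lt (PosNum xn).
  have [n2 h2] : exists n2 : nat, - x < n2%:R.
    by exists (Num.bound (- x)); exact: archi_boundP (ltW xn).
  apply: (hn (maxn n1 n2)); apply/andP; split.
    rewrite ltrNl; apply: (lt_le_trans h2); rewrite ler_nat.
    exact: (leq_trans (leq_maxr n1 n2)).
  rewrite lerNr; apply: ltW; apply: le_lt_trans h1.
  rewrite lef_pV2 ?posrE ?ltr0n// ler_nat ltnS.
  exact: leq_maxl.
have mK' : measurable_fun [set: Tc] (fun x => (K x)%:E) by exact/measurable_EFinP.
by apply/(ae_eq_integral_abs mu measurableT mK').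
Qed.

End vanishing.

Lemma integrable_funepos_funeneg d (T : measurableType d) (R : realType)
    (m : {measure set T -> \bar R}) (h : T -> \bar R) :
  measurable_fun setT h -> (\int[m]_x h^\+ x < +oo)%E ->
  (\int[m]_x h^\- x < +oo)%E -> m.-integrable setT h.
Proof.
move=> mh hp hn; apply/integrableP; split=> //.
rewrite (eq_integral (fun x => h^\+ x + h^\- x)%E); last first.
  by move=> x _; rewrite -[RHS]/((h^\+ \+ h^\-)%E x) -fune_abse.
rewrite ge0_integralD//; first exact: lte_add_pinfty.
- exact: measurable_funepos.
- exact: measurable_funeneg.
Qed.

(** * Positivity of the form and truncation *)

Section integrally_positive_definite_C1.
Context (R : realType).
Notation mu := (@completed_lebesgue_measure R).
Notation leb := (@lebesgue_measure R).
Notation Tc := (caratheodory_type (@wlength R idfun)^*%mu).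

Lemma C1_ge0 (x y : R) : 0 <= C1 x y.
Proof. by rewrite /C1; case: ifP => // _; rewrite le_min !normr_ge0. Qed.

Lemma C1_le (x y : R) : C1 x y <= `|x|.
Proof. by rewrite /C1; case: ifP => // _; rewrite ge_min lexx. Qed.

Lemma measurable_C1_comp d (T : measurableType d) (f g : T -> R) :
  measurable_fun setT f -> measurable_fun setT g ->
  measurable_fun setT (fun t => C1 (f t) (g t)).
Proof.
move=> mf mg; apply: measurable_fun_ifT.
- by apply: measurable_fun_ler; [exact: measurable_cst|exact: measurable_funM].
- by apply: measurable_minr; apply: measurableT_comp.
- exact: measurable_cst.
Qed.

Lemma measurable_C1 : measurable_fun [set: Tc * Tc] (fun p : Tc * Tc => C1 (p.1 : R) (p.2 : R)).
Proof.
have m1 : measurable_fun [set: Tc * Tc] (fun z => z.1 : R).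
  exact: (measurableT_comp (@measurable_id_completed R) (@measurable_fst _ _ _ _)).
have m2 : measurable_fun [set: Tc * Tc] (fun z => z.2 : R).
  exact: (measurableT_comp (@measurable_id_completed R) (@measurable_snd _ _ _ _)).
exact: (measurable_C1_comp m1 m2).
Qed.

Lemma measurable_C1_form (K : R -> R) : measurable_fun [set: Tc] K ->
  measurable_fun [set: Tc * Tc]
    (fun p : Tc * Tc => (K p.1 * K p.2 * C1 (p.1 : R) (p.2 : R))%:E).
Proof.
move=> mK; apply/measurable_EFinP; apply: (measurable_funM _ measurable_C1).
apply: measurable_funM.
- exact: (measurableT_comp mK (@measurable_fst _ _ _ _)).
- exact: (measurableT_comp mK (@measurable_snd _ _ _ _)).
Qed.

Section form.
Variable K : R -> R.
Hypothesis mK : measurable_fun [set: Tc] K.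
Let h (p : Tc * Tc) : \bar R := (K p.1 * K p.2 * C1 (p.1 : R) (p.2 : R))%:E.

Lemma C1_form_ge0 : ((mu \x mu)%E).-integrable setT h ->
  (0 <= \int[(mu \x mu)%E]_p h p)%E.
Proof.
move=> ih; exact: (@quadratic_form_ge0 _ Tc R mu (@layer R) (@C1 R) K
  (@measurable_layer R) (@layer_ge0 R) (@integral_layer R) mK ih).
Qed.

Lemma C1_form_gt0 : (0 < \int[mu]_x `|(K x)%:E|)%E ->
  ((mu \x mu)%E).-integrable setT h -> (0 < \int[(mu \x mu)%E]_p h p)%E.
Proof.
move=> K0 ih; rewrite ltNge; apply/negP => h0.
have := @quadratic_form_eq0 _ Tc R mu (@layer R) (@C1 R) K
  (@measurable_layer R) (@layer_ge0 R) (@integral_layer R) mK ih h0.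
by move=> /(layer_determining mK) KE; move: K0; rewrite KE ltxx.
Qed.

End form.

Section truncation.
Variable K : R -> R.
Hypothesis mK : measurable_fun [set: Tc] K.
Let h (p : Tc * Tc) : \bar R := (K p.1 * K p.2 * C1 (p.1 : R) (p.2 : R))%:E.
Hypothesis hp : (\int[(mu \x mu)%E]_p h^\+ p < +oo)%E.

Let mh : measurable_fun [set: Tc * Tc] h.
Proof. exact: measurable_C1_form. Qed.

Let D (n : nat) : set Tc := [set x : Tc | `|x : R| <= n%:R /\ `|K x| <= n%:R].

Let mD n : measurable (D n).
Proof.
have m1 : measurable_fun [set: Tc] (fun x : Tc => (`|x : R| <= n%:R)%R).
  apply: measurable_fun_ler; last exact: measurable_cst.
  exact: (measurableT_comp (@normr_measurable R setT) (@measurable_id_completed R)).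
have m2 : measurable_fun [set: Tc] (fun x : Tc => (`|K x| <= n%:R)%R).
  apply: measurable_fun_ler; last exact: measurable_cst.
  exact: (measurableT_comp (@normr_measurable R setT) mK).
have := measurable_and m1 m2 => /(_ measurableT [set true] I); rewrite setTI => h'.
congr (measurable _): h'; apply/seteqP; split=> x /=.
  by move=> /andP[].
by move=> [-> ->].
Qed.

Let muD n : (mu (D n) < +oo)%E.
Proof.
have mI : measurable (`[- n%:R, n%:R]%classic : set Tc) by exact: sub_caratheodory.
have sub : D n `<=` `[- n%:R, n%:R]%classic.
  by move=> x [+ _]; rewrite ler_norml /= in_itv/=.
apply: (@le_lt_trans _ _ (mu `[- n%:R, n%:R]%classic)).
  by apply: le_measure => //; rewrite inE//; exact: mD.
have -> : mu `[- n%:R, n%:R]%classic = leb `[- n%:R, n%:R]%classic by [].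
by rewrite lebesgue_measure_itv/=; case: ifP => _; rewrite ?ltry// -EFinB ltry.
Qed.

Let Kn n (x : R) : R := K x * \1_(D n) x.

Let mKn n : measurable_fun [set: Tc] (Kn n).
Proof. exact: (measurable_funM mK (measurable_indic (mD n))). Qed.

Let hn n (p : Tc * Tc) : \bar R := (Kn n p.1 * Kn n p.2 * C1 (p.1 : R) (p.2 : R))%:E.

Let hnE n p : hn n p = (h p * (\1_(D n `*` D n) p)%:E)%E.
Proof.
rewrite /hn /h /Kn -EFinM; congr EFin.
have -> : \1_(D n `*` D n) p = \1_(D n) p.1 * \1_(D n) p.2 :> R.
  by rewrite !indicE in_setX; case: (_ \in _); case: (_ \in _); rewrite ?mulr1 ?mulr0.
ring.
Qed.

Let mhn n : measurable_fun [set: Tc * Tc] (hn n).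
Proof. exact: (measurable_C1_form (mKn n)). Qed.

Let mDD n : measurable (D n `*` D n).
Proof. exact: (measurableX (mD n) (mD n)). Qed.

Let ihn n : ((mu \x mu)%E).-integrable setT (hn n).
Proof.
(* In the bound [n ^ 3], each value of [K] accounts for one factor and [C1 x y <= |x|] for the
   third. *)
apply: (@le_integrable _ _ R (mu \x mu)%E setT measurableT _
  (fun p => (n%:R ^+ 3 * \1_(D n `*` D n) p)%:E)) => //.
- move=> p _; rewrite hnE /h -EFinM !lee_fin indicE.
  case: (boolP (p \in _)) => [|_]; last by rewrite !mulr0.
  rewrite inE => -[[x1 k1] [x2 k2]]; rewrite !mulr1.
  rewrite [leRHS]ger0_norm ?exprn_ge0//.
  rewrite !normrM exprSr expr2 ler_pM ?mulr_ge0//; first by rewrite ler_pM.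
  by rewrite ger0_norm ?C1_ge0// (le_trans (C1_le _ _)).
- under eq_fun do rewrite EFinM; apply: integrableZl => //.
  apply/integrableP; split; first by apply/measurable_EFinP; exact: (measurable_indic (mDD n)).
  under eq_integral do rewrite gee0_abs ?lee_fin//.
  rewrite integral_indic//= setIT.
  have -> : ((mu \x mu) (D n `*` D n) = mu (D n) * mu (D n))%E.
    exact: (product_measure1E mu mu (mD n) (mD n)).
  by rewrite lte_mul_pinfty// ?muD// ge0_fin_numE// muD.
Qed.

Let hneg_n n p : (hn n)^\-%E p = (h^\- p * (\1_(D n `*` D n) p)%:E)%E.
Proof.
rewrite !funenegE hnE indicE; case: (_ \in _); first by rewrite !mule1.
by rewrite !mule0 oppe0 maxxx.
Qed.

Let hpos_n n p : ((hn n)^\+ p <= h^\+ p)%E.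
Proof.
rewrite !funeposE hnE indicE; case: (_ \in _); first by rewrite mule1.
by rewrite mule0 maxxx le_max lexx orbT.
Qed.

Let int_hneg_n n : (\int[(mu \x mu)%E]_p (hn n)^\- p <= \int[(mu \x mu)%E]_p h^\+ p)%E.
Proof.
apply: (@le_trans _ _ (\int[(mu \x mu)%E]_p (hn n)^\+ p)%E); last first.
  by apply: ge0_le_integral => //; [exact: measurable_funepos (mhn n)|exact: measurable_funepos mh].
have := C1_form_ge0 (mKn n) (ihn n).
rewrite integralE sube_ge0//; apply/orP; left; rewrite ge0_fin_numE; last first.
  by apply: integral_ge0.
exact: (integral_funeneg_lt_pinfty measurableT (ihn n)).
Qed.

(** Truncating [K] multiplies [h] by the indicator of [D n] times [D n], so the negative parts of
    [hn n] increase to that of [h]; the bound [int_hneg_n], uniform in [n], passes to the limit by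
    monotone convergence. *)
Lemma truncated_funeneg : (\int[(mu \x mu)%E]_p h^\- p < +oo)%E.
Proof.
apply: le_lt_trans hp.
have mono : forall p, nondecreasing_seq (fun n => (hn n)^\- p)%E.
  move=> p n k nk; rewrite !hneg_n; apply: lee_wpmul2l => //.
  rewrite lee_fin !indicE ler_nat; case: (boolP (p \in D n `*` D n)) => //.
  rewrite !inE => -[[x1 k1] [x2 k2]]; rewrite mem_set//=.
  have nk' : n%:R <= k%:R :> R by rewrite ler_nat.
  by split; split; apply: le_trans nk'.
have := @cvg_monotone_convergence _ _ R (mu \x mu)%E setT measurableT
  (fun n => (hn n)^\-)%E (fun n => measurable_funeneg (mhn n))
  (fun n x _ => funeneg_ge0 _ x) (fun x _ => mono x).
have limE p : (limn (fun n => (hn n)^\- p) = h^\- p)%E.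
  apply: cvg_lim => //; apply: cvg_near_cst.
  have [b [b1 b2]] : exists b : nat, (`|p.1 : R| <= b%:R /\ `|K p.1| <= b%:R) /\
      (`|p.2 : R| <= b%:R /\ `|K p.2| <= b%:R).
    pose s : R := `|p.1 : R| + `|K p.1| + `|p.2 : R| + `|K p.2|.
    have s0 : 0 <= s by rewrite !addr_ge0.
    exists (Num.bound s); have := ltW (archi_boundP s0).
    rewrite /s; have := normr_ge0 (p.1 : R); have := normr_ge0 (p.2 : R).
    have := normr_ge0 (K p.1); have := normr_ge0 (K p.2).
    move: (Num.bound _)%:R => r h1 h2 h3 h4 h5.
    by split; split; lra.
  exists b => // n bn; rewrite /= hneg_n indicE mem_set ?mule1//=.
  have bn' : b%:R <= n%:R :> R by rewrite ler_nat.
  by case: b1 => b1 b1'; case: b2 => b2 b2'; split; split=> /=; apply: le_trans bn'.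
under [X in _ --> X]eq_integral do rewrite limE.
move=> cv; rewrite -(cvg_lim _ cv)//; apply: lime_le; first by apply/cvg_ex; eexists; exact: cv.
by apply: nearW => n; exact: int_hneg_n.
Qed.

End truncation.

Lemma integrally_positive_definite_C1 : integrally_positive_definite (@C1 R).
Proof.
rewrite /integrally_positive_definite => K mK K0 wd.
have mh := measurable_C1_form mK.
have hn : (\int[(mu \x mu)%E]_p (fun p => (K p.1 * K p.2 * C1 p.1 p.2)%:E)^\- p < +oo)%E.
  by case: wd => // hp; exact: truncated_funeneg.
have [hp|hp] := ltP (\int[(mu \x mu)%E]_p (fun p => (K p.1 * K p.2 * C1 p.1 p.2)%:E)^\+ p)%E +oo%E.
  by apply: C1_form_gt0 => //; exact: integrable_funepos_funeneg.
(* An infinite positive part against a finite negative one: the integral is [+oo]. *)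
rewrite integralE; move: hp; rewrite leye_eq => /eqP ->.
rewrite addye//.
by rewrite eqe_oppLR /=; exact: (negbT (lt_eqF hn)).
Qed.

End integrally_positive_definite_C1.

Theorem proposition2p4 (R : realType) :
  (forall (d : measure_display) (Om : measurableType d) (P : probability Om R)
     (F : R -> set (set Om)) (W : R -> Om -> R) (T : R)
     (sigma V f g : R -> Om -> R) (M : R),
     0 < T ->
     complete_filtration P F ->
     wiener_process P F W ->
     (forall (t : R) (w : Om), 0 <= t <= T -> V t w = sigma t w ^+ 2) ->
     adapted F T f -> progressively_measurable F T f ->
     adapted F T g -> progressively_measurable F T g ->
     ito_process P F W T f g V ->
     (forall t : R, 0 <= t <= T -> ('E_P[fun w => (f t w ^+ 2)%R] < M%:E)%E) ->
     (forall t : R, 0 <= t <= T -> 'E_P[fun w => (g t w ^+ 2)%R]%E \is a fin_num) ->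
     {within `[0, T], continuous (fun t : R => fine 'E_P[fun w => (g t w ^+ 2)%R]%E)} ->
     let L := fun t : R => fine 'E_P[fun w => (g t w ^+ 2)%R]%E in
     let cov := fun t r s : R =>
       'E_P[fun w => ((V (t + r) w - V t w) * (V (t + s) w - V t w))%R]%E in
     forall t : R, 0 < t < T ->
       (forall r s : R, 0 <= t + r <= T -> 0 <= t + s <= T ->
          cov t r s \is a fin_num) /\
       (fun p : R * R => fine (cov t p.1 p.2) : R^o) =
       (fun p : R * R => L t * C1 p.1 p.2 : R^o)
         +o_ (nbhs ((0, 0) : R * R))
       (fun p : R * R => Num.sqrt (p.1 ^+ 2 + p.2 ^+ 2) : R^o)) /\
  integrally_positive_definite (@C1 R).
Proof.
split; last exact: integrally_positive_definite_C1.
move=> d Om P F W T sigma V f g M T0 hF hW _ _ _ _ _ hV hf hg cL L cov t tT.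
split; first by move=> r s; exact: (covariance_fin_num hF hW T0 hV hf).
apply/eqaddoP => e e0.
have [dl dl0 hdl] := covariance_expansion hF hW T0 hV hf hg tT cL e0.
(* Balls of the product are squares, which is the form of neighbourhood in
   [covariance_expansion]. *)
apply/nbhs_ballP; exists dl => // -[r s] [/= r_dl s_dl].
rewrite [X in _ <= e * X]ger0_norm ?sqrtr_ge0//.
move: r_dl s_dl; rewrite -!ball_normE /= !sub0r !normrN => r_dl s_dl.
exact: hdl r_dl s_dl.
Qed.
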